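(* Let $X$ be a real Banach space with single-valued normalized duality mapping $J:X\to X^*$, let $N\ge 1$, let $F_1,\dots,F_N:X\to X$ be operators and $f_1,\dots,f_N\in X$, and put $A_i(x)=F_i(x)-f_i$. Assume that $S=\{x\in X:A_i(x)=0,\ i=1,\dots,N\}$ is nonempty, and let $\varphi$ be a function such that at least one of the following two sets of conditions holds. (A) Every $A_i$ is $\varphi$-inverse uniformly accretive (with the same $\varphi$); $J$ is sequentially weakly continuous and continuous; $X$ is smooth and reflexive and possesses the approximation. (B) Every $A_i$ is $m$-accretive and $\varphi$-inverse uniformly accretive (with the same $\varphi$); $X$ is uniformly smooth and uniformly convex. Let $\widehat{x}^*$ be the unique element of $S$ satisfying $\langle \widehat{x}^*, J(\widehat{x}^*-x^* )\rangle\le 0$ for all $x^*\in S$. Let $\{\alpha_n\}_{n\ge 0}$, $\{\gamma_n\}_{n\ge0}$ be sequences of positive real numbers such that (i) $\alpha_n\to 0$ and $\gamma_n\to+\infty$ as $n\to+\infty$; (ii) $\dfrac{\gamma_n|\alpha_{n+1}-\alpha_n|}{\alpha_n^2}\to 0$ as $n\to+\infty$, and $\sum_{n=1}^\infty \dfrac{\alpha_n}{\gamma_n}=+\infty$; (iii) $\dfrac{h_X(\tau_n)\,\varphi_R^{-1}(R_1\alpha_n)}{\alpha_n}\to 0$ as $n\to+\infty$, where $\tau_n=\gamma_n^{-1}$, $R>0$ is a fixed number with $R\ge 2\|\widehat{x}^*\|$, and $R_1=\frac{3R^2}{2}$. Assume also that for every fixed $s>0$, $\dfrac{\varphi(s,t)}{t}\to+\infty$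 as $t\to+\infty$. For all $n\ge 0$ and $i=1,\dots,N$ let $F_{n,i}:X\to X$ be accretive operators and $f_{n,i}\in X$ such that $$\|F_{n,i}(x)-F_i(x)\|\le h_n\, g(\|x\|)\ \ \text{for all }x\in X,\qquad \|f_{n,i}-f_i\|\le\delta_n,$$ where $g:[0,\infty)\to[0,\infty)$ is continuous and nondecreasing and $h_n>0$, $\delta_n>0$. If $\dfrac{h_n+\delta_n}{\alpha_n}\to 0$ as $n\to+\infty$, then any sequence $\{z_n\}$ generated, from an arbitrary $z_0\in X$, for $n=0,1,2,\dots$ by $$F_{n,i}(z_n^i)-f_{n,i}+\Big(\frac{\alpha_n}{N}+\gamma_n\Big)z_n^i=\gamma_n z_n,\quad i=1,\dots,N,\qquad z_{n+1}=\frac1N\sum_{i=1}^N z_n^i,$$ converges strongly to $\widehat{x}^*$ as $n\to+\infty$.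
   Context: The normalized duality mapping $J:X\to X^*$ satisfies $\langle x,J(x)\rangle=\|x\|^2=\|J(x)\|^2$ for all $x\in X$; it is assumed single valued. An operator $A:X\to X$ is accretive if $\langle A(x)-A(y),J(x-y)\rangle\ge 0$ for all $x,y\in X$; it is $m$-accretive if it is accretive and the range of $A+\alpha I$ is $X$ for all $\alpha>0$. A continuous operator $A:X\to X$ is $\varphi$-inverse uniformly accretive if $\varphi:(0,\infty)\times[0,\infty)\to[0,\infty)$ is continuous and strictly increasing in the second variable, $\varphi(s,t)=0$ if and only if $t=0$ for every fixed $s>0$, and $$\langle A(x)-A(y),J(x-y)\rangle\ge \varphi(R,\|A(x)-A(y)\|)\quad\text{for all } R>0 \text{ and all } x,y\in X \text{ with } \|x\|,\|y\|\le R.$$ For fixed $s>0$, $\varphi_s^{-1}$ denotes the inverse function of $t\mapsto\varphi(s,t)$. $X$ possesses the approximation if there is a directed family of finite-dimensional subspaces $X_n$ ordered by inclusion, with corresponding projectors $P_n:X\to X_n$, such that $\|P_n\|=1$ for all $n\ge 0$ and $\bigcup_n X_n$ is dense in $X$. The modulus of smoothness is $\rho_X(\tau)=\sup\{\frac{\|x+y\|+\|x-y\|}{2}-1:\|x\|=1,\|y\|=\tau\}$, and $h_X(\tau)=\rho_X(\tau)/\tau$. $X$ is uniformly smooth if $h_X(\tau)\to 0$ as $\tau\to 0$. *)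

(* Defs.v *)
(* MathComp-Analysis *)
From HB Require Import structures.
From mathcomp Require Import all_boot all_order all_algebra.
From mathcomp Require Import all_classical all_reals all_analysis.

Set Implicit Arguments.
Unset Strict Implicit.
Unset Printing Implicit Defensive.

Import Order.TTheory GRing.Theory Num.Theory.
Import numFieldNormedType.Exports.

Local Open Scope classical_set_scope.
Local Open Scope ring_scope.

Section dual_space.
Context {R : realType} {X : normedModType R}.

Definition continuous_functional : {pred X -> R^o} :=
  [pred f : X -> R^o | `[< linear f /\ continuous f >]].

Lemma continuous_functional_submod_closed : submod_closed continuous_functional.
Proof.
split.
  apply/asboolP; split; last by move=> x; exact: cvg_cst.
  by move=> a u v; rewrite /= scaler0 addr0.
move=> a f g /asboolP[lf cf] /asboolP[lg cg]; apply/asboolP; split.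
  move=> b u v; rewrite !fctE lf lg !scalerDr !addrA; congr (_ + _).
  rewrite -!addrA; congr (_ + _); last by rewrite addrC.
  by rewrite !scalerA mulrC.
move=> x; apply: cvgD; last exact: cg.
by apply: cvgZl_tmp; exact: cf.
Qed.

HB.instance Definition _ := GRing.isSubmodClosed.Build _ _ continuous_functional
  continuous_functional_submod_closed.

End dual_space.

Record dual (R : realType) (X : normedModType R) := Dual {
  dual_val :> X -> R^o ;
  dual_valP : dual_val \in continuous_functional }.

HB.instance Definition _ (R : realType) (X : normedModType R) :=
  [isSub for @dual_val R X].
HB.instance Definition _ (R : realType) (X : normedModType R) :=
  [Choice of dual X by <:].
HB.instance Definition _ (R : realType) (X : normedModType R) :=
  [SubChoice_isSubLmodule of dual X by <:].

(* sup is 0 on unbounded sets, so a nonzero value forces f to be bounded on the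
   unit ball. *)
Definition operator_norm {R : realType} {U V : normedModType R} (f : U -> V) : R :=
  sup [set `|f x| | x in [set x : U | `|x| <= 1]].

Section dual_normed.
Context {R : realType} {X : normedModType R}.
Implicit Types f g : dual X.

Definition dual_norm f : R := operator_norm f.

Lemma dual_linear f : linear (f : X -> R^o).
Proof. by have /asboolP[] := dual_valP f. Qed.

Lemma dual_continuous f : continuous (f : X -> R^o).
Proof. by have /asboolP[] := dual_valP f. Qed.

HB.instance Definition _ f :=
  GRing.isLinear.Build R X R^o _ (dual_val f) (dual_linear f).

Lemma has_sup_dual_norm f :
  has_sup [set `|f x| | x in [set x : X | `|x| <= 1]].
Proof.
split; first by exists `|f 0|; exists 0 => //=; rewrite normr0.
have /bounded_funP/(_ 1)[M fM] := continuous_linear_bounded 0 (@dual_continuous f 0).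
by exists M => _ [x /= x1 <-]; exact: fM.
Qed.

Lemma dual_norm_ub f x : `|x| <= 1 -> `|f x| <= dual_norm f.
Proof.
by move=> x1; apply: ub_le_sup; [case: (has_sup_dual_norm f)|exists x].
Qed.

Lemma dual_norm_lub f (M : R) :
  (forall x, `|x| <= 1 -> `|f x| <= M) -> dual_norm f <= M.
Proof.
move=> fM; apply: ge_sup; first by case: (has_sup_dual_norm f).
by move=> _ [x /= x1 <-]; exact: fM.
Qed.

Lemma dual_norm_ge0 f : 0 <= dual_norm f.
Proof.
by rewrite (le_trans (normr_ge0 (f 0)))// dual_norm_ub// normr0.
Qed.

Lemma dual_normD f g :
  dual_norm (f + g) <= dual_norm f + dual_norm g.
Proof.
apply: dual_norm_lub => x x1.
by rewrite (le_trans (ler_normD (f x) (g x)))// lerD// dual_norm_ub.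
Qed.

Lemma dual_normZ_le (a : R) f :
  dual_norm (a *: f) <= `|a| * dual_norm f.
Proof.
apply: dual_norm_lub => x x1.
rewrite (_ : (a *: f) x = a * f x)// normrM.
by rewrite ler_wpM2l// dual_norm_ub.
Qed.

Lemma dual_normZ (a : R) f :
  dual_norm (a *: f) = `|a| * dual_norm f.
Proof.
apply/eqP; rewrite eq_le dual_normZ_le/=.
have [->|a0] := eqVneq a 0; first by rewrite normr0 mul0r dual_norm_ge0.
rewrite -ler_pdivlMl ?normr_gt0// -normfV.
by have := dual_normZ_le a^-1 (a *: f); rewrite scalerA mulVf// scale1r.
Qed.

Lemma dual_norm_eq0 f : dual_norm f = 0 -> f = 0.
Proof.
move=> f0; apply/val_inj/funext => x /=.
have [->|x0] := eqVneq x 0; first by rewrite linear0.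
have : `|f (`|x|^-1 *: x)| <= 0.
  by rewrite -f0 dual_norm_ub// normrZ normfV normr_id mulVf ?normr_eq0.
rewrite normr_le0 linearZ/= => /eqP /(congr1 (fun y => `|x| * y)).
by rewrite mulr0 /GRing.scale/= mulrA divff ?normr_eq0// mul1r.
Qed.

HB.instance Definition _ := Lmodule_isNormed.Build R (dual X)
  dual_normD dual_normZ dual_norm_eq0.

End dual_normed.

Section geometry.
Context {R : realType}.

Definition duality_map {X : normedModType R} (x : X) : set (dual X) :=
  [set f : dual X | f x = `|x| ^+ 2 /\ `|f| ^+ 2 = `|x| ^+ 2].

Definition weak_cvg {X : normedModType R} (u : nat -> X) (x : X) : Prop :=
  forall f : dual X, f (u n) @[n --> \oo] --> f x.

Definition seq_weakly_continuous {X Y : normedModType R} (T : X -> Y) : Prop :=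
  forall u x, weak_cvg u x -> weak_cvg (T \o u) (T x).

Definition reflexive_space (X : normedModType R) : Prop :=
  forall Phi : dual (dual X), exists x : X, forall f : dual X, Phi f = f x.

Definition smooth_space (X : normedModType R) : Prop :=
  forall x : X, `|x| = 1 -> exists! f : dual X, `|f| = 1 /\ f x = 1.

Definition uniformly_convex (X : normedModType R) : Prop :=
  forall e : R, 0 < e -> exists2 d : R, 0 < d &
    forall x y : X, `|x| = 1 -> `|y| = 1 -> e <= `|x - y| ->
      `|2^-1 *: (x + y)| <= 1 - d.

Definition modulus_of_smoothness (X : normedModType R) (tau : R) : R :=
  sup [set e | exists x y : X, [/\ `|x| = 1, `|y| = tau &
    e = (`|x + y| + `|x - y|) / 2 - 1]].

Definition smoothness_quotient (X : normedModType R) (tau : R) : R :=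
  modulus_of_smoothness X tau / tau.

Definition uniformly_smooth (X : normedModType R) : Prop :=
  smoothness_quotient X tau @[tau --> 0^'+] --> (0 : R).

Definition findim_subspace {X : normedModType R} (Y : set X) : Prop :=
  exists d (b : 'I_d -> X), Y = range (fun c : 'I_d -> R => \sum_i c i *: b i).

Definition has_approximation (X : normedModType R) : Prop :=
  exists (Y : nat -> set X) (P : nat -> {linear X -> X}),
  [/\ forall n, findim_subspace (Y n),
      forall m n, exists k, Y m `|` Y n `<=` Y k,
      forall n, [/\ continuous (P n), range (P n) = Y n
                  & forall x, Y n x -> P n x = x],
      forall n, operator_norm (P n) = 1
    & dense (\bigcup_n Y n)].

End geometry.

Section accretivity.
Context {R : realType} {X : normedModType R} (J : X -> dual X).

Definition accretive (A : X -> X) : Prop :=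
  forall x y, 0 <= J (x - y) (A x - A y).

Definition m_accretive (A : X -> X) : Prop :=
  accretive A /\
  forall alpha : R, 0 < alpha -> range (fun x => A x + alpha *: x) = setT.

(* phi s t is only relevant for s > 0 and t >= 0; joint continuity in (s, t) is
   not required. *)
Definition accretivity_gauge (phi : R -> R -> R) : Prop :=
  forall s, 0 < s ->
  [/\ forall t, 0 <= t -> 0 <= phi s t,
      {within `[0, +oo[, continuous (phi s)},
      forall t u, 0 <= t -> t < u -> phi s t < phi s u
    & forall t, 0 <= t -> (phi s t = 0 <-> t = 0)].

Definition inverse_uniformly_accretive (phi : R -> R -> R) (A : X -> X) : Prop :=
  [/\ continuous A, accretivity_gauge phi
    & forall (s : R) (x y : X), 0 < s -> `|x| <= s -> `|y| <= s ->
        phi s `|A x - A y| <= J (x - y) (A x - A y)].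

End accretivity.

(* Inverse of phi s : [0, +oo[ -> [0, +oo[, with value 0 outside its range. *)
Definition gauge_inverse {R : realType} (phi : R -> R -> R) (s : R) : R -> R :=
  'pinv_(fun=> 0) `[0, +oo[ (phi s).

Definition common_zeros {R : realType} {X : normedModType R} {N : nat}
  (A : 'I_N -> X -> X) : set X := [set x | forall i, A i x = 0].

(* Main.v *)
Require Import Defs.
From HB Require Import structures.
From mathcomp Require Import all_boot all_order all_algebra.
From mathcomp Require Import all_classical all_reals all_analysis.
From mathcomp Require Import ring lra.

Set Implicit Arguments.
Unset Strict Implicit.
Unset Printing Implicit Defensive.

Import Order.TTheory GRing.Theory Num.Theory.
Import numFieldNormedType.Exports.

Local Open Scope classical_set_scope.
Local Open Scope ring_scope.

(** Write [A_i] for the exact operators, [tau_n = 1 / gamma_n], [h_X] for the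
smoothness quotient, and let [x_n] solve the regularized equation
[sum_i A_i x_n + alpha_n x_n = 0].  The proof shows that [x_n] tends to [xhat]
and that [z_n - x_n] tends to 0.

The solutions [x_n] exist because a superlinear gauge makes each [A_i] bounded
and uniformly continuous on balls ([inverse_uniformly_accretive_ball_uniform]),
and in any Banach space an accretive operator with these two properties,
perturbed by a positive multiple of the identity, is onto
([accretive_solvable]): explicit Euler steps get trapped in a small ball, and a
trajectory with nearly constant velocity can only be trapped if this velocity is
small ([euler_small_residual]).

Testing the regularized equation with [J (x_n - y)], for a common zero [y],
gives [J (x_n - y) x_n <= 0], the bound [|x_n - xhat| <= |xhat|], and
[|A_i x_n| <= phi_r^-1 (r1 alpha_n)].  For the limit of [x_n]
([regularization_path_cvg]) it is enough that every subsequence has a cluster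
point which is a common zero, since the inequality [J (x_n - y) x_n <= 0] passes
to the limit and characterizes [xhat].  When [J] is weakly continuous, the cluster
point is a weak limit of a subsequence, and the limit is then strong
([weak_limit_common_zero], [weak_limit_strong]).  When the space is uniformly
convex and uniformly smooth, it is the asymptotic centre of the subsequence along
an ultrafilter: resolvents fix the centre, and smoothness shows that a positive
asymptotic radius could be decreased ([ultralimit_smooth_convex]).

For the iteration, put [w = z_n - x_n] and
[b_i = A_i x_n + (alpha_n / N) x_n].  Each implicit step contracts by the factor
[1 / (1 + alpha_n tau_n / N)] ([implicit_step_le]), so that [z_{n+1} - x_n] is
controlled by the mean of the numbers [|w - tau_n b_i|].  As the [b_i] add up to zero, the first order
terms of these norms cancel in the mean, and only a smoothness error
[2 tau_n |b_i| h_X(tau_n)] is left ([mean_smooth_le]).  The equation for [x_n] also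
bounds [alpha_n |x_n|] by the norms [|A_i x_n|], so [|b_i|] is at most
[2 phi_r^-1 (r1 alpha_n)] and this error is small compared with
[alpha_n tau_n]; so are the data errors and the shift from [x_n] to [x_{n+1}].
The contraction factor therefore wins as long as [|w|] stays away from 0, and the
divergence of the series of [alpha_n tau_n] gives the conclusion
([descent_cvg0]). *)

(** * The duality mapping and accretive operators *)

Section duality.
Context {R : realType} {X : normedModType R}.
Implicit Types (f : dual X) (x y : X).

Lemma dual_le_norm f x : `|f x : R| <= `|f| * `|x|.
Proof.
have [->|x0] := eqVneq x 0; first by rewrite linear0 !normr0 mulr0.
have nx : 0 < `|x| by rewrite normr_gt0.
have : `|f (`|x|^-1 *: x)| <= `|f|.
  by apply: dual_norm_ub; rewrite normrZ normfV normr_id mulVf ?gt_eqF.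
by rewrite linearZ/= normrZ normfV normr_id mulrC ler_pdivrMr.
Qed.

(** Limits of functionals and evaluations at a point are first known only as plain
functions; this turns them into elements of the dual. *)
Lemma dual_of_bounded_linear (f : X -> R) (C : R) :
  linear (f : X -> R^o) -> (forall x, `|f x| <= C * `|x|) ->
  exists g : dual X, (forall x, g x = f x) /\ `|g| <= `|C|.
Proof.
move=> lf fC.
pose l := GRing.isLinear.Build R X R^o _ (f : X -> R^o) lf.
pose F : {linear X -> R^o} := HB.pack (f : X -> R^o) l.
have cF : continuous F.
  apply: bounded_linear_continuous.
  exists `|C|; split; first exact: num_real.
  move=> M CM; near=> x => /=.
  have x1 : `|x| <= 1.
    near: x; apply/nbhs_normP; exists 1 => //= x; rewrite /ball_/= sub0r normrN.
    exact: ltW.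
  apply: (le_trans (fC x)); apply: le_trans (ltW CM).
  rewrite (le_trans (ler_norm _))// normrM normr_id.
  by rewrite ler_piMr.
have P : (f : X -> R^o) \in continuous_functional by apply/asboolP; split.
exists (Dual P); split => //.
apply: dual_norm_lub => x x1 /=.
apply: (le_trans (fC x)).
rewrite (le_trans (ler_norm _))// normrM normr_id.
by rewrite ler_piMr.
Unshelve. all: by end_near. Qed.

End duality.

Section pairing.
Context {R : realType} {X : normedModType R} (J : X -> dual X).
Hypothesis hJ : forall x, duality_map x = [set J x].
Implicit Types x y w : X.

Lemma duality_self x : J x x = `|x| ^+ 2 :> R.
Proof.
have : [set J x] (J x) by [].
by rewrite -hJ => -[].
Qed.

Lemma duality_norm x : `|J x| = `|x|.
Proof.
have : [set J x] (J x) by [].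
rewrite -hJ => -[_ /eqP].
by rewrite eqrXn2// => /eqP.
Qed.

Lemma duality_le x y : (J x y : R) <= `|x| * `|y|.
Proof. by rewrite (le_trans (ler_norm _))// -duality_norm dual_le_norm. Qed.

Lemma duality_ge x y : - (`|x| * `|y|) <= (J x y : R).
Proof.
by rewrite lerNl (le_trans (ler_norm _))// normrN -duality_norm dual_le_norm.
Qed.

Lemma duality_eq x (f : dual X) :
  f x = `|x| ^+ 2 :> R -> `|f| = `|x| -> f = J x.
Proof.
move=> fx nf; have : duality_map x f by split; rewrite ?nf.
by rewrite hJ.
Qed.

(** Pairing the right-hand side with [J (x - y)] discards the accretive part.
Nonexpansiveness of resolvents and stability of regularized solutions follow from
it. *)
Lemma accretive_expansive (B : X -> X) (l : R) x y : accretive J B ->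
  l * `|x - y| <= `|B x - B y + l *: (x - y)|.
Proof.
move=> aB.
have [->|xy] := eqVneq x y; first by rewrite !subrr normr0 mulr0.
have n0 : 0 < `|x - y| by rewrite normr_gt0 subr_eq0.
rewrite -(ler_pM2l n0).
apply: le_trans (duality_le (x - y) _).
rewrite linearD linearZ/=.
have -> : `|x - y| * (l * `|x - y|) = l *: (J (x - y) (x - y)) :> R.
  by rewrite duality_self /GRing.scale/=; ring.
by rewrite lerDr; exact: aB.
Qed.

Lemma accretive_sum n (A : 'I_n -> X -> X) :
  (forall i, accretive J (A i)) -> accretive J (fun x => \sum_(i < n) A i x).
Proof.
move=> aA x y; rewrite -sumrB linear_sum; apply: sumr_ge0 => i _; exact: aA.
Qed.

End pairing.

(** * The modulus of smoothness *)

Section smoothness.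
Context {R : realType} {X : normedModType R}.
Implicit Types x y w : X.

Lemma modulus_of_smoothness_ub x y : `|x| = 1 ->
  (`|x + y| + `|x - y|) / 2 - 1 <= modulus_of_smoothness X `|y|.
Proof.
move=> x1; apply: ub_le_sup; last by exists x, y.
exists `|y| => _ [u [v [u1 vy ->]]].
have := ler_normD u v; have := ler_normB u v; lra.
Qed.

Lemma smoothness_quotient_ge0 (t : R) : 0 < t ->
  0 <= smoothness_quotient X t.
Proof.
move=> t0; apply: divr_ge0; last exact: ltW.
rewrite /modulus_of_smoothness; set E := [set _ | _].
have [->|/set0P[_ [x [y [x1 yt _]]]]] := eqVneq E set0; first by rewrite sup0.
have := modulus_of_smoothness_ub y x1; rewrite yt; apply: le_trans.
suff : 2 <= `|x + y| + `|x - y| by lra.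
have := ler_normD (x + y) (x - y).
have -> : x + y + (x - y) = 2 *: x by rewrite addrACA subrr addr0 scaler_nat.
by rewrite normrZ x1 ger0_norm; lra.
Qed.

(** When [`|y|] equals [t * `|w|], this is the definition of the modulus after
scaling.  A shorter [y] lies on the segment from 0 to such a vector, and convexity
of the norm transfers the estimate in proportion to [`|y|]: the quotient stays
evaluated at [t], which is the monotonicity of [h_X]. *)
Lemma norm_secant_le (t : R) w y : 0 < t -> `|y| <= t * `|w| ->
  `|w + y| + `|w - y| <= 2 * `|w| + 2 * `|y| * smoothness_quotient X t.
Proof.
move=> t0 ytw.
have [->|y0] := eqVneq y 0.
  by rewrite addr0 subr0 normr0 mulr0 mul0r; lra.
have ny : 0 < `|y| by rewrite normr_gt0.
have nw : 0 < `|w| by rewrite -(pmulr_rgt0 _ t0) (lt_le_trans ny).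
pose s := `|y| / (t * `|w|).
have tw : 0 < t * `|w| by rewrite mulr_gt0.
have s0 : 0 < s by rewrite divr_gt0.
have s1 : s <= 1 by rewrite ler_pdivrMr// mul1r.
pose u := `|w|^-1 *: w; pose v := (t / `|y|) *: y.
have u1 : `|u| = 1 by rewrite normrZ normfV normr_id mulVf// gt_eqF.
have vt : `|v| = t.
  by rewrite normrZ gtr0_norm ?divr_gt0// divfK// gt_eqF.
have sv : (s * `|w|) *: v = y.
  rewrite scalerA (_ : _ * _ = 1) ?scale1r// /s; field.
  by rewrite !gt_eqF.
have wE : w = (1 - s) *: w + (s * `|w|) *: u.
  rewrite scalerA mulfK ?gt_eqF// -scalerDl.
  by rewrite subrK scale1r.
have e1 : `|1 - s| = 1 - s by rewrite ger0_norm ?subr_ge0.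
have e2 : `|s * `|w| | = s * `|w| by rewrite gtr0_norm// mulr_gt0.
have h1 : `|w + y| <= (1 - s) * `|w| + s * `|w| * `|u + v|.
  rewrite {1}wE -{1}sv -addrA -scalerDr (le_trans (ler_normD _ _))//.
  by rewrite 2!normrZ e1 e2.
have h2 : `|w - y| <= (1 - s) * `|w| + s * `|w| * `|u - v|.
  rewrite {1}wE -{1}sv -addrA -scalerBr (le_trans (ler_normD _ _))//.
  by rewrite 2!normrZ e1 e2.
have h3 := modulus_of_smoothness_ub v u1; rewrite vt in h3.
have h4 : `|y| * smoothness_quotient X t = s * `|w| * modulus_of_smoothness X t.
  rewrite /smoothness_quotient /s; field.
  by rewrite !gt_eqF.
have sw : 0 < s * `|w| by rewrite mulr_gt0.
rewrite -mulrA h4; move: h1 h2 h3; move: (modulus_of_smoothness X t) => rho.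
move=> h1 h2 h3.
have := ler_wpM2l (ltW sw) h3.
lra.
Qed.

(** The functional [J w / `|w|] supports the norm at [w], which bounds [`|w + y|]
from below by its linear part; the secant estimate then bounds [`|w - y|] from
above with the same linear part, up to the smoothness error. *)
Lemma norm_sub_smooth (J : X -> dual X) (t : R) w y :
  (forall x, duality_map x = [set J x]) ->
  w != 0 -> 0 < t -> `|y| <= t * `|w| ->
  `|w - y| <= `|w| - (J w y : R) / `|w| + 2 * `|y| * smoothness_quotient X t.
Proof.
move=> hJ w0 t0 ytw.
have nw : 0 < `|w| by rewrite normr_gt0.
have := norm_secant_le t0 ytw.
have : `|w| + (J w y : R) / `|w| <= `|w + y|.
  rewrite -(ler_pM2l nw); apply: le_trans (duality_le hJ w _).
  rewrite linearD/= (duality_self hJ).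
  rewrite mulrDr mulrCA mulfV ?gt_eqF// mulr1; exact: lexx.
lra.
Qed.

End smoothness.

(** * Solvability of accretive equations *)

(** Cantor intersection for the sublevel sets of [G], whose diameters shrink to 0.
It serves both for a residual norm and for the radius of an asymptotic centre. *)
Lemma well_posed_limit (R : realType) (X : completeNormedModType R) (G : X -> R) :
  (forall e, 0 < e -> exists x, G x < e) ->
  (forall e, 0 < e -> exists2 d, 0 < d &
     forall x y, G x < d -> G y < d -> `|x - y| <= e) ->
  exists x, forall e d, 0 < e -> 0 < d -> exists2 y, G y < d & `|x - y| <= e.
Proof.
move=> Ginf Gdiam.
have pos k : 0 < k.+1%:R^-1 :> R by rewrite invr_gt0 ltr0Sn.
have /choice[u uG] : forall k : nat, exists x, G x < k.+1%:R^-1.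
  by move=> k; exact/Ginf.
have small d : 0 < d -> \forall k \near \oo, G (u k) < d.
  move=> d0; near=> k; apply: lt_trans (uG k) _.
  by near: k; exact: near_infty_natSinv_lt (PosNum d0).
have cu : cvg (u @ \oo).
  apply/cauchy_cvgP; apply/cauchyP => e e0.
  have [d d0 Gd] := Gdiam _ (divr_gt0 e0 (ltr0Sn R 1)).
  have [k _ uk] := small _ d0.
  exists (u k); exists k => // n /= kn.
  rewrite -ball_normE /ball_/=.
  apply: le_lt_trans (Gd _ _ (uk k (leqnn k)) (uk n kn)) _.
  by rewrite ltr_pdivrMr//; lra.
exists (lim (u @ \oo)) => e d e0 d0.
near \oo => k.
exists (u k); first by near: k; exact: small.
by near: k; apply: cvgr_dist_le.
Unshelve. all: by end_near. Qed.

(** The regularity of operators under which explicit Euler steps can be controlled. *)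
Definition ball_uniform {R : realType} {X : normedModType R} (B : X -> X) :=
  forall K, (exists M, forall x, `|x| <= K -> `|B x| <= M) /\
    forall e, 0 < e -> exists2 d, 0 < d & forall x y,
      `|x| <= K -> `|y| <= K -> `|x - y| <= d -> `|B x - B y| <= e.

Section ball_uniform_theory.
Context {R : realType} {X : normedModType R}.
Implicit Types B : X -> X.

Lemma ball_uniformD B C : ball_uniform B -> ball_uniform C ->
  ball_uniform (fun x => B x + C x).
Proof.
move=> bB bC K; have [[M MB] uB] := bB K; have [[M' MC] uC] := bC K.
split.
  exists (M + M') => x xK.
  by rewrite (le_trans (ler_normD _ _))// lerD ?MB ?MC.
move=> e e0; have e20 : 0 < e / 2 by rewrite divr_gt0.
have [d d0 dB] := uB _ e20; have [d' d'0 dC] := uC _ e20.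
exists (Num.min d d'); first by rewrite lt_min d0.
move=> x y xK yK; rewrite le_min => /andP[xyd xyd'].
rewrite opprD addrACA (le_trans (ler_normD _ _))//.
by rewrite (splitr e) lerD ?dB ?dC.
Qed.

Lemma ball_uniform_cst a : ball_uniform (fun _ : X => a).
Proof.
move=> K; split; first by exists `|a|.
by move=> e e0; exists 1 => // x y _ _ _; rewrite subrr normr0 ltW.
Qed.

Lemma ball_uniformZ (l : R) : ball_uniform (fun x : X => l *: x).
Proof.
move=> K; split.
  by exists (`|l| * K) => x xK; rewrite normrZ ler_wpM2l.
have l0 : 0 < `|l| + 1 by rewrite ltr_wpDl.
move=> e e0; exists (e / (`|l| + 1)); first by rewrite divr_gt0.
move=> x y _ _ xy; rewrite -scalerBr normrZ.
apply: le_trans (ler_wpM2l (normr_ge0 l) xy) _.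
rewrite mulrA ler_pdivrMr// mulrC; apply: ler_wpM2l; first exact: ltW.
by rewrite lerDl.
Qed.

Lemma ball_uniform_sum n (A : 'I_n -> X -> X) :
  (forall i, ball_uniform (A i)) -> ball_uniform (fun x => \sum_(i < n) A i x).
Proof.
elim: n A => [|n IH] A bA.
  have -> : (fun x => \sum_(i < 0) A i x) = fun=> 0.
    by apply/funext => x; rewrite big_ord0.
  exact: ball_uniform_cst.
have -> : (fun x => \sum_(i < n.+1) A i x) =
    fun x => \sum_(i < n) A (widen_ord (leqnSn n) i) x + A ord_max x.
  by apply/funext => x; rewrite big_ord_recr.
by apply: ball_uniformD; [exact: IH|exact: bA].
Qed.

End ball_uniform_theory.

Section solvability.
Context {R : realType} {X : normedModType R}.

(** Explicit Euler steps [x_{k+1} = x_k - t T x_k] are implicit steps up to an error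
[t * eta], where [eta] bounds the change of [T] over one step.  Strong accretivity
therefore keeps the iterates in a fixed ball, and makes two shifted trajectories
contract up to [2 * eta / a].  Hence, after a time independent of [m], all the
[x_{k+m}] stay within [d1] of [x_k].  On that scale [T] is almost constant, so
[x_{k+m}] drifts like [x_k - m t T x_k]; being trapped while [m] is arbitrary, the
velocity [T x_k] has to be small. *)
Lemma euler_small_residual (T : X -> X) (a : R) : 0 < a ->
  (forall (t : R) x y, 0 <= t ->
     (1 + a * t) * `|x - y| <= `|x - y + t *: (T x - T y)|) ->
  ball_uniform T ->
  exists K, forall e, 0 < e -> exists2 x, `|x| <= K & `|T x| <= e.
Proof.
move=> a0 aT bT.
pose rho := (1 + `|T 0|) / a; exists rho.
have rho0 : 0 < rho by rewrite divr_gt0// ltr_pwDl.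
have [[M0 M0T] uT] := bT (rho + 1).
pose M := `|M0|.
have MT x : `|x| <= rho + 1 -> `|T x| <= M.
  by move=> xr; rewrite (le_trans (M0T _ xr))// ler_norm.
have M_ge0 : 0 <= M by exact: normr_ge0.
move=> e e0.
have [d1 d10 d1T] := uT _ (divr_gt0 e0 (ltr0Sn R 1)).
(* With this [eta] the trapping radius [4 * eta / a] is at most [d1]. *)
pose eta := Num.min 1 (a * d1 / 4).
have eta0 : 0 < eta by rewrite lt_min ltr01/= divr_gt0// mulr_gt0.
have [d2 d20 d2T] := uT _ eta0.
(* One Euler step moves by at most [t * M], that is by at most 1 and [d2]. *)
pose t := Num.min 1 d2 / (M + 1).
have M1 : 0 < M + 1 by rewrite ltr_wpDl.
have t0 : 0 < t by rewrite divr_gt0// lt_min ltr01.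
have nt v : `|t *: v| = t * `|v| :> R by rewrite normrZ gtr0_norm.
have tM : t * M <= Num.min 1 d2.
  rewrite /t mulrAC ler_pdivrMr// ler_wpM2l ?lerDl//.
  by rewrite le_min ler01/= ltW.
pose x k := iter k (fun y => y - t *: T y) 0.
have xS k : x k.+1 = x k - t *: T (x k) by [].
have step k : `|x k| <= rho -> `|x k.+1| <= rho + 1 /\ `|T (x k.+1) - T (x k)| <= eta.
  move=> xk; have xk1 : `|x k| <= rho + 1 by rewrite (le_trans xk)// lerDl.
  have tT : `|t *: T (x k)| <= t * M.
    by rewrite nt ler_pM2l// MT.
  have xk1' : `|x k.+1| <= rho + 1.
    rewrite xS (le_trans (ler_normB _ _))// lerD// (le_trans tT)//.
    by rewrite (le_trans tM)// ge_min lexx.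
  split => //; apply: d2T => //.
  rewrite xS addrAC subrr add0r normrN (le_trans tT)//.
  by rewrite (le_trans tM)// ge_min lexx orbT.
have at0 : 0 < a * t by rewrite mulr_gt0.
have w0 : 0 < 1 + a * t by rewrite addr_gt0.
have xb k : `|x k| <= rho.
  elim: k => [|k IH]; first by rewrite /x/= normr0 ltW.
  have [_ dT] := step k IH.
  have := aT t (x k.+1) 0 (ltW t0); rewrite subr0.
  have -> : x k.+1 + t *: (T (x k.+1) - T 0) =
      x k + (t *: (T (x k.+1) - T (x k)) - t *: T 0).
    rewrite xS -addrA; congr (_ + _); rewrite !scalerBr.
    by rewrite addrA [X in X - _]addrC.
  move=> h; suff : (1 + a * t) * `|x k.+1| <= (1 + a * t) * rho.
    by rewrite ler_pM2l//; lra.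
  apply: (le_trans h); rewrite (le_trans (ler_normD _ _))//.
  rewrite mulrDl mul1r lerD// (le_trans (ler_normB _ _))//.
  rewrite 2!nt -mulrDr.
  have -> : a * t * rho = t * (1 + `|T 0|) by rewrite /rho; field; rewrite gt_eqF.
  rewrite ler_pM2l// lerD// (le_trans dT)//.
  by rewrite ge_min lexx.
have dT k : `|T (x k.+1) - T (x k)| <= eta by have [] := step k (xb k).
have xb1 k : `|x k| <= rho + 1 by rewrite (le_trans (xb k))// lerDl.
(* [q] is the fixed point of the recursion [(1 + a * t) * d = d + 2 * t * eta]
   which bounds the distance between shifted trajectories. *)
pose q := 2 * eta / a.
have contract m k :
    (1 + a * t) ^+ k * (`|x (k + m)%N - x k| - q) <= 2 * rho.
  elim: k => [|k IH].
    rewrite expr0 mul1r add0n; apply: (@le_trans _ _ `|x m - x 0%N|).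
      rewrite gerDl oppr_le0; apply: divr_ge0; last exact: ltW.
      by rewrite mulr_ge0// ltW.
    rewrite (le_trans (ler_normB _ _))//.
    by have := xb m; have := xb 0%N; lra.
  apply: le_trans IH; rewrite exprSr -mulrA ler_pM2l; last first.
    exact: exprn_gt0.
  have := aT t (x (k + m).+1) (x k.+1) (ltW t0).
  have -> : x (k + m).+1 - x k.+1 + t *: (T (x (k + m).+1) - T (x k.+1)) =
    (x (k + m)%N - x k) + (t *: (T (x (k + m).+1) - T (x (k + m)%N))
      - t *: (T (x k.+1) - T (x k))).
    rewrite {1}(xS (k + m)%N) {1}(xS k) !scalerBr !opprD !opprK !addrA.
    by rewrite [LHS](ACl (1*3*5*2*6*4)%AC).
  move=> h.
  have : `|x (k + m)%N - x k + (t *: (T (x (k + m).+1) - T (x (k + m)%N))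
      - t *: (T (x k.+1) - T (x k)))| <= `|x (k + m)%N - x k| + 2 * t * eta.
    rewrite (le_trans (ler_normD _ _))// lerD2l (le_trans (ler_normB _ _))//.
    rewrite 2!nt -mulrDr (_ : 2 * t * eta = t * (2 * eta)); last by ring.
    rewrite ler_pM2l//.
    by have := dT k; have := dT (k + m)%N; lra.
  move=> /(le_trans h); rewrite addSn.
  have -> : 2 * t * eta = a * t * q by rewrite /q; field; rewrite gt_eqF.
  lra.
have [k qk] : exists k, 2 * rho <= (1 + a * t) ^+ k * q.
  have q0 : 0 < q by rewrite divr_gt0// mulr_gt0.
  exists (Num.Def.archi_bound (2 * rho / (q * (a * t)))).
  set k := Num.Def.archi_bound _.
  have : 2 * rho / (q * (a * t)) <= k%:R.
    by apply/ltW/archi_boundP/divr_ge0; apply/ltW; rewrite mulr_gt0.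
  rewrite ler_pdivrMr; last by rewrite mulr_gt0.
  move=> h.
  apply: (le_trans h); rewrite mulrCA mulrC ler_pM2r//.
  (* The geometric factor dominates the linear one, by Bernoulli. *)
  apply: (@le_trans _ _ (1 + k%:R * (a * t))); first by rewrite lerDr.
  elim: (k) => [|j IH]; first by rewrite mul0r addr0 expr0.
  rewrite exprSr; apply: (@le_trans _ _ ((1 + j%:R * (a * t)) * (1 + a * t))).
    rewrite -natr1; have : 0 <= j%:R * (a * t) * (a * t).
      by do 2?[apply: mulr_ge0; last exact: ltW].
    lra.
  by rewrite ler_pM2r//; lra.
have near_k m : `|x (k + m)%N - x k| <= d1.
  have h : `|x (k + m)%N - x k| - q <= q.
    rewrite -(@ler_pM2l _ ((1 + a * t) ^+ k)).
      exact: le_trans (contract m k) qk.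
    exact: exprn_gt0.
  have : q + q <= d1.
    rewrite /q -mulrDl ler_pdivrMr//.
    have : eta <= a * d1 / 4 by rewrite ge_min lexx orbT.
    lra.
  lra.
exists (x k) => //.
pose v := T (x k).
have drift m : `|x (k + m)%N - x k + (m%:R * t) *: v| <= m%:R * t * (e / 2).
  elim: m => [|m IH].
    by rewrite addn0 subrr mul0r scale0r addr0 normr0 mul0r.
  rewrite addnS xS.
  have -> : x (k + m)%N - t *: T (x (k + m)%N) - x k + (m.+1%:R * t) *: v =
     (x (k + m)%N - x k + (m%:R * t) *: v) - t *: (T (x (k + m)%N) - v).
    rewrite -natr1 mulrDl mul1r scalerDl scalerBr opprB.
    by rewrite !addrA [LHS](ACl (1*3*4*5*2)%AC).
  rewrite (le_trans (ler_normB _ _))//.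
  rewrite -natr1 !mulrDl mul1r lerD// nt ler_pM2l//.
  exact: d1T.
pose m := (Num.Def.archi_bound (2 * d1 / (t * e))).+1.
have mE : 2 * d1 / (t * e) <= m%:R.
  rewrite ltW// (@lt_trans _ _ (Num.Def.archi_bound (2 * d1 / (t * e)))%:R)//.
    by apply/archi_boundP/divr_ge0; apply/ltW; rewrite mulr_gt0.
  by rewrite ltr_nat.
rewrite ler_pdivrMr in mE; last by rewrite mulr_gt0.
have m0 : 0 < m%:R * t by rewrite mulr_gt0.
rewrite -/v -(ler_pM2l m0).
have -> : m%:R * t * `|v| = `|(m%:R * t) *: v| by rewrite normrZ gtr0_norm.
have -> : (m%:R * t) *: v = (x (k + m)%N - x k + (m%:R * t) *: v) - (x (k + m)%N - x k).
  by rewrite addrAC subrr add0r.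
rewrite (le_trans (ler_normB _ _))//.
have := near_k m; have := drift m.
have -> : m%:R * t * (e / 2) = m%:R * (t * e) / 2 by field.
rewrite -[m%:R * t * e]mulrA; move: (m%:R * (t * e)) mE => w mE; lra.
Qed.

End solvability.

Section solvability_complete.
Context {R : realType} {X : completeNormedModType R} (J : X -> dual X).
Hypothesis hJ : forall x, duality_map x = [set J x].

(** Residuals of the shifted operator can be made arbitrarily small, and small
residuals force approximate solutions to be close to each other. *)
Lemma accretive_solvable (B : X -> X) (a : R) (y : X) : 0 < a ->
  accretive J B -> ball_uniform B -> exists x, B x + a *: x = y.
Proof.
move=> a0 aB bB.
pose T x := B x + (a *: x + - y).
have TB p q : T p - T q = B p - B q + a *: (p - q).
  by rewrite /T scalerBr !opprD !opprK !addrA [LHS](ACl (1*4*2*5*(3*6))%AC)/= addNr addr0.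
have bT : ball_uniform T.
  do 2![apply: ball_uniformD => //]; first exact: ball_uniformZ.
  exact: ball_uniform_cst.
have expT t p q : 0 <= t ->
    (1 + a * t) * `|p - q| <= `|p - q + t *: (T p - T q)|.
  move=> t0; have atB : accretive J (fun x => t *: B x).
    by move=> u v; rewrite -scalerBr linearZ; apply: mulr_ge0 => //; exact: aB.
  apply: le_trans (accretive_expansive hJ (1 + a * t) p q atB) _.
  rewrite TB -(scalerBr t (B p)) [t *: (_ + a *: _)]scalerDr scalerA scalerDl scale1r [t * a]mulrC.
  by rewrite addrCA.
have [K KT] := euler_small_residual a0 expT bT.
have [||x xT] := @well_posed_limit R X (fun x => `|T x|).
- move=> e e0; have [x _ xe] := KT _ (divr_gt0 e0 (ltr0Sn R 1)).
  by exists x; rewrite (le_lt_trans xe)// ltr_pdivrMr//; lra.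
- move=> e e0; exists (a * e / 2); first by rewrite divr_gt0// mulr_gt0.
  move=> p q Tp Tq; rewrite -(ler_pM2l a0).
  apply: le_trans (accretive_expansive hJ a p q aB) _.
  by rewrite -TB (le_trans (ler_normB _ _))//; lra.
exists x; apply/eqP; rewrite -subr_eq0 -addrA -normr_le0.
apply/ler_addgt0Pr => e e0; rewrite add0r.
have [_ /(_ _ (divr_gt0 e0 (ltr0Sn R 1)))[d d0 dT]] := bT (`|x| + 1).
have [||z zT xz] := xT (Num.min 1 d) (e / 2).
- by rewrite lt_min ltr01.
- by rewrite divr_gt0.
move: xz; rewrite le_min => /andP[xz1 xzd].
have zx : `|z| <= `|x| + 1.
  have -> : z = x - (x - z) by rewrite opprB addrC subrK.
  by rewrite (le_trans (ler_normB _ _))// lerD2l.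
have := dT x z; rewrite lerDl => /(_ ler01 zx xzd) xzT.
rewrite -/(T x) -[T x](subrK (T z)) (le_trans (ler_normD _ _))//; lra.
Qed.

End solvability_complete.

(** * Inverse uniform accretivity *)

Section gauge.
Context {R : realType} (phi : R -> R -> R).
Hypothesis hphi : accretivity_gauge phi.
Hypothesis phi_superlinear : forall s, 0 < s -> phi s t / t @[t --> +oo] --> +oo.
Variables (s : R) (s_gt0 : 0 < s).

Lemma gauge_gt0 t : 0 < t -> 0 < phi s t.
Proof.
move=> t0; have [p0 _ mono _] := hphi s_gt0.
exact: le_lt_trans (p0 0 (lexx 0)) (mono _ _ (lexx 0) t0).
Qed.

Lemma gauge_le t u : 0 <= t -> t <= u -> phi s t <= phi s u.
Proof.
move=> t0; rewrite le_eqVlt => /predU1P[->//|tu].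
by have [_ _ /(_ t u t0 tu)/ltW] := hphi s_gt0.
Qed.

Lemma gauge_eventually_ge (M : R) : exists2 T, 1 <= T &
  forall t, T <= t -> M * t <= phi s t.
Proof.
have /cvgryPge/(_ M) := phi_superlinear s_gt0.
move=> [T [_ hT]]; exists (Num.max 1 (T + 1)); first by rewrite le_max lexx.
move=> t; rewrite ge_max => /andP[t1 Tt].
have t0 : 0 < t by lra.
by rewrite -ler_pdivlMr//; apply: hT => /=; lra.
Qed.

(** Superlinearity and the intermediate value theorem put every [c >= 0] in the range
of the gauge, so that [gauge_inverse] is a true inverse at [c] and not its default
value. *)
Lemma gauge_inverse_ge t c : 0 <= t -> phi s t <= c -> t <= gauge_inverse phi s c.
Proof.
move=> t0 tc; have [p0 cphi mono _] := hphi s_gt0.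
have c0 : 0 <= c by exact: le_trans (p0 _ t0) tc.
have [T T1 hT] := gauge_eventually_ge c.
have T0 : 0 <= T by exact: le_trans ler01 T1.
have cT : c <= phi s T.
  by apply: le_trans (hT T (lexx T)); rewrite ler_peMr.
have p00 : phi s 0 <= c by apply: le_trans tc; exact: gauge_le.
have [||u] := @IVT _ (phi s) 0 T c T0.
- apply: continuous_subspaceW cphi => x /=; rewrite !in_itv/= andbT.
  by case/andP.
- by rewrite ge_min p00 le_max cT orbT.
rewrite in_itv/= => /andP[u0 _] uc.
have -> : gauge_inverse phi s c = u.
  rewrite /gauge_inverse -uc pinvKV//; last by rewrite inE/= in_itv/= u0.
  move=> x y; rewrite !inE/= !in_itv/= !andbT => x0 y0 xy.
  by case: (ltgtP x y) => // [/(mono _ _ x0)|/(mono _ _ y0)]; rewrite xy ltxx.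
by rewrite leNgt; apply/negP => /(mono _ _ u0); rewrite uc ltNge tc.
Qed.

End gauge.

Section inverse_uniform.
Context {R : realType} {X : normedModType R} (J : X -> dual X).
Hypothesis hJ : forall x, duality_map x = [set J x].
Variables (phi : R -> R -> R) (A : X -> X).
Hypothesis hA : inverse_uniformly_accretive J phi A.

Lemma inverse_uniformly_accretive_accretive : accretive J A.
Proof.
have [_ hphi phiA] := hA => x y.
have s0 : 0 < `|x| + `|y| + 1 by rewrite ltr_wpDl// addr_ge0.
apply: le_trans (phiA _ _ _ s0 _ _).
- by have [p0 _ _ _] := hphi _ s0; apply: p0.
- by rewrite -addrA lerDl addr_ge0.
- by rewrite [`|x| + _]addrC -addrA lerDl addr_ge0.
Qed.

Hypothesis phi_superlinear : forall s, 0 < s -> phi s t / t @[t --> +oo] --> +oo.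

(** With [t = `|A x - A y|], the accretivity inequality gives
[phi s t <= `|x - y| * t].  Since [phi s t / t] tends to infinity, [t] stays below a
constant [T] on the ball; then [phi s t <= `|x - y| * T] is small when [x] and [y]
are close, and so is [t] by monotonicity. *)
Lemma inverse_uniformly_accretive_ball_uniform : ball_uniform A.
Proof.
have [_ hphi phiA] := hA => K.
pose s := `|K| + 1.
have s0 : 0 < s by rewrite ltr_wpDl.
have Ks x : `|x| <= K -> `|x| <= s.
  move=> xK; rewrite (le_trans xK)// (le_trans (ler_norm _))//.
  by rewrite lerDl.
have phi_le x y : `|x| <= s -> `|y| <= s ->
    phi s `|A x - A y| <= `|x - y| * `|A x - A y|.
  by move=> xs ys; apply: le_trans (phiA _ _ _ s0 xs ys) (duality_le hJ _ _).
have [T T1 hT] := gauge_eventually_ge phi_superlinear s0 (2 * s + 1).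
have osc x y : `|x| <= s -> `|y| <= s -> `|A x - A y| <= T.
  move=> xs ys; rewrite leNgt; apply/negP => TA.
  have t0 : 0 < `|A x - A y| by apply: lt_trans TA; exact: lt_le_trans T1.
  have := le_trans (hT _ (ltW TA)) (phi_le _ _ xs ys); rewrite ler_pM2r//.
  by have := ler_normB x y; lra.
split.
  exists (T + `|A 0|) => x xK; rewrite -[A x](subrK (A 0)).
  rewrite (le_trans (ler_normD _ _))// lerD2r; apply: osc; first exact: Ks.
  by rewrite normr0 ltW.
have T0 : 0 < T by exact: lt_le_trans T1.
move=> e e0; have pe := gauge_gt0 hphi s0 e0.
exists (phi s e / (2 * T)); first by rewrite divr_gt0// mulr_gt0.
move=> x y /Ks xs /Ks ys xyd; rewrite leNgt; apply/negP => eA.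
have h1 := le_trans (gauge_le hphi s0 (ltW e0) (ltW eA)) (phi_le _ _ xs ys).
have h2 : `|x - y| * `|A x - A y| <= phi s e / (2 * T) * T.
  by apply: ler_pM => //; exact: osc.
have h3 : phi s e / (2 * T) * T = phi s e / 2 by field; rewrite gt_eqF.
by move: (le_trans h1 h2); rewrite h3; lra.
Qed.

End inverse_uniform.

(** * Limits along ultrafilters *)

Section ultralimits.
Context {R : realType} (U : set_system nat) {FU : UltraFilter U}.

Lemma bounded_ultralimit (u : nat -> R) (C : R) : (forall n, `|u n| <= C) ->
  exists l : R, u n @[n --> U] --> l.
Proof.
move=> uC.
have UI : (u @ U) `[- C, C]%classic.
  by apply: (@filterE _ U) => n /=; rewrite in_itv/= -ler_norml.
have [l [_ cl]] := @segment_compact R (- C) C (u @ U) _ UI.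
exists l => B lB.
have [//|nB] := in_ultra_setVsetC (u @^-1` B) FU.
by have [x [/= nBx Bx]] := cl (~` B) B nB lB.
Qed.

Lemma ultralimit_le (u v : nat -> R) (a b : R) :
  u n @[n --> U] --> a -> v n @[n --> U] --> b -> (forall n, u n <= v n) ->
  a <= b.
Proof.
move=> ua vb uv.
by apply: (ler_cvg_to ua vb); exact: filterE.
Qed.

(** Weak-star compactness of balls of the dual, for one sequence: the pointwise limit
along the ultrafilter is again linear and bounded. *)
Lemma dual_ultralimit (V : normedModType R) (G : nat -> dual V) (C : R) :
  (forall n, `|G n| <= C) ->
  exists g : dual V, forall v, G n v @[n --> U] --> g v.
Proof.
move=> GC.
have bG v n : `|G n v : R| <= C * `|v|.
  by rewrite (le_trans (dual_le_norm _ _))// ler_wpM2r.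
have /choice[l Gl] : forall v, exists l : R, G n v @[n --> U] --> l.
  by move=> v; exact: bounded_ultralimit (bG v).
have lin : linear (l : V -> R^o).
  move=> a v w.
  have : G n (a *: v + w) @[n --> U] --> a *: l v + l w.
    have -> : (fun n => G n (a *: v + w)) = (fun n => a *: G n v + G n w).
      by apply/funext => n; rewrite linearP.
    by apply: cvgD; [apply: cvgZl_tmp|]; exact: Gl.
  exact: (cvg_unique (@Rhausdorff R) (Gl _)).
have bl v : `|l v| <= C * `|v|.
  by apply: (ultralimit_le (cvg_norm (Gl v)) (cvg_cst _)) => n; exact: bG.
have [g [gl _]] := dual_of_bounded_linear lin bl.
by exists g => v; rewrite gl; exact: Gl.
Qed.

End ultralimits.

Section demicontinuity.
Context {R : realType} {X : normedModType R} (J : X -> dual X).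
Hypothesis hJ : forall x, duality_map x = [set J x].

(** A weak-star limit [g] of [J (w n)] satisfies the two conditions that define the
duality mapping at [w0], and single-valuedness leaves no other choice than
[J w0]. *)
Lemma duality_demicontinuous (U : set_system nat) (w : nat -> X) (w0 : X) (C : R) :
  UltraFilter U -> (forall n, `|w n| <= C) -> w n @[n --> U] --> w0 ->
  forall v, (J (w n) v : R) @[n --> U] --> (J w0 v : R).
Proof.
move=> FU wC ww0.
have JC n : `|J (w n)| <= C by rewrite (duality_norm hJ).
have [g Jg] := dual_ultralimit JC.
suff -> : J w0 = g by [].
have gw0 : g w0 = `|w0| ^+ 2 :> R.
  apply/eqP; rewrite -subr_eq0 -normr_le0.
  have h1 : `|(J (w n) w0 : R) - `|w n| ^+ 2| @[n --> U]
      --> `|(g w0 : R) - `|w0| ^+ 2|.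
    apply: cvg_norm; apply: cvgB; first exact: Jg.
    by apply: cvgM; exact: cvg_norm.
  have h2 : C * `|w0 - w n| @[n --> U] --> C * `|w0 - w0|.
    by apply: cvgM; [exact: cvg_cst|apply: cvg_norm; apply: cvgB => //; exact: cvg_cst].
  rewrite subrr normr0 mulr0 in h2.
  apply: (ultralimit_le h1 h2) => n.
  rewrite -(duality_self hJ).
  have -> : (J (w n) w0 : R) - (J (w n) (w n) : R) = J (w n) (w0 - w n).
    by rewrite linearB.
  by rewrite (le_trans (dual_le_norm _ _))// ler_wpM2r.
symmetry; apply: (duality_eq hJ gw0).
apply/eqP; rewrite eq_le; apply/andP; split.
  apply: dual_norm_lub => x x1.
  have h1 : `|J (w n) x : R| @[n --> U] --> `|g x : R|.
    by apply: cvg_norm; exact: Jg.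
  apply: (ultralimit_le h1 (cvg_norm ww0)) => n.
  by rewrite (le_trans (dual_le_norm _ _))// (duality_norm hJ) ler_piMr.
have [->|w00] := eqVneq w0 0; first by rewrite normr0.
have nw0 : 0 < `|w0| by rewrite normr_gt0.
rewrite -(ler_pM2r nw0) -expr2 -gw0.
exact: le_trans (ler_norm _) (dual_le_norm _ _).
Qed.

End demicontinuity.

(** * Weak sequential compactness *)

Section weak_compactness.
Context {R : realType}.

Lemma dual_evaluation (X : normedModType R) (x : X) :
  exists Phi : dual (dual X), (forall f, Phi f = f x) /\ `|Phi| <= `|x|.
Proof.
have lin : linear ((fun f : dual X => f x) : dual X -> R^o) by [].
have evC (f : dual X) : `|f x : R| <= `|x| * `|f| by rewrite mulrC dual_le_norm.
have [Phi [PhiE nPhi]] := dual_of_bounded_linear lin evC.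
by exists Phi; rewrite normr_id in nPhi.
Qed.

(** Along an ultrafilter, the evaluations at [u n] converge in the bidual, and
reflexivity represents the limit by a point. *)
Lemma reflexive_ultralimit (X : normedModType R) (U : set_system nat)
    (u : nat -> X) (C : R) : reflexive_space X -> UltraFilter U ->
  (forall n, `|u n| <= C) ->
  exists x : X, forall f : dual X, (f (u n) : R) @[n --> U] --> (f x : R).
Proof.
move=> rX FU uC.
have /choice[ev evE] := fun n => dual_evaluation (u n).
have evC n : `|ev n| <= C by have [_ /le_trans] := evE n; apply.
have [Phi PhiE] := dual_ultralimit evC.
have [x xE] := rX Phi.
exists x => f; have := PhiE f; rewrite xE.
by under eq_fun do rewrite (evE _).1.
Qed.

Lemma subseq_cvg (T : topologicalType) (u : nat -> T) (l : T) (c : nat -> nat) :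
  (forall k, (k <= c k)%N) -> u n @[n --> \oo] --> l ->
  u (c k) @[k --> \oo] --> l.
Proof.
move=> ck; apply: cvg_comp => B [n _ nB].
by exists n => // k /= nk; apply: nB; exact: leq_trans (ck k).
Qed.

Lemma not_cvg_subseq (V : normedModType R) (u : nat -> V) (l : V) :
  ~ (u n @[n --> \oo] --> l) ->
  exists2 e : R, 0 < e & exists2 c : nat -> nat, forall k, (k <= c k)%N &
    forall k, e <= `|l - u (c k)|.
Proof.
move=> ul; apply: contrapT => H; apply: ul.
apply/cvgrPdist_lt => e e0; apply: contrapT => ue; apply: H.
exists e => //.
suff /choice[c cE] : forall k, exists n, (k <= n)%N /\ e <= `|l - u n|.
  by exists c => k; have [] := cE k.
move=> k; apply: contrapT => H; apply: ue.
exists k => // n /= kn; rewrite ltNge; apply/negP => un.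
by apply: H; exists n.
Qed.

Definition dense_sequence {X : normedModType R} (D : nat -> X) :=
  forall v (e : R), 0 < e -> exists j, `|D j - v| < e.

(** If [D j] is close to [v], then [J (D j) v = 0] bounds [`|D j|] by the distance
from [D j] to [v], so that [v] itself is small. *)
Lemma dense_duality_separates (X : normedModType R) (J : X -> dual X)
    (D : nat -> X) (v : X) :
  (forall x, duality_map x = [set J x]) -> dense_sequence D ->
  (forall j, J (D j) v = 0 :> R) -> v = 0.
Proof.
move=> hJ dD Dv; apply/eqP; rewrite -normr_le0; apply/ler_addgt0Pr => e e0.
have [j jv] := dD v _ (divr_gt0 e0 (ltr0Sn R 1)).
have Dj : `|D j| <= `|D j - v|.
  have [->|Dj0] := eqVneq (D j) 0; first by rewrite normr0.
  have nD : 0 < `|D j| by rewrite normr_gt0.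
  rewrite -(ler_pM2l nD) -expr2 -(duality_self hJ).
  have -> : J (D j) (D j) = J (D j) (D j - v) by rewrite linearB/= Dv subr0.
  exact: (duality_le hJ).
have -> : v = D j - (D j - v) by rewrite opprB addrC subrK.
by rewrite add0r (le_trans (ler_normB _ _))//; lra.
Qed.

(** The functionals [J (D j)] form a countable separating family.  A subsequence along
which they all converge to their value at an ultrafilter limit [x] is found by
picking indices in sets of the ultrafilter.  It converges weakly to [x]: any
ultrafilter limit of a further subsequence agrees with [x] on the separating
family. *)
Lemma reflexive_weak_subseq (X : normedModType R) (J : X -> dual X)
    (D : nat -> X) (u : nat -> X) (C : R) :
  (forall x, duality_map x = [set J x]) -> dense_sequence D ->
  reflexive_space X -> (forall n, `|u n| <= C) ->
  exists2 c : nat -> nat, forall k, (k <= c k)%N &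
    exists x, weak_cvg (u \o c) x.
Proof.
move=> hJ dD rX uC.
have [U [FU sU]] := ultraFilterLemma eventually_filter.
have [x xU] := reflexive_ultralimit rX FU uC.
suff /choice[c cE] : forall k, exists n, (k <= n)%N /\
    forall j, (j <= k)%N -> `|(J (D j) x : R) - J (D j) (u n)| < k.+1%:R^-1.
  exists c => [k|]; first by have [] := cE k.
  exists x => f; apply: contrapT => /not_cvg_subseq[e e0 [d kd de]].
  have [x' x'U] := reflexive_ultralimit rX FU (fun n => uC (c (d n))).
  suff xx' : x' = x.
    have h : `|(f x : R) - f (u (c (d n)))| @[n --> U] --> `|(f x : R) - f x'|.
      by apply: cvg_norm; apply: cvgB; [exact: cvg_cst|exact: x'U].
    have : e <= `|(f x : R) - f x'| by apply: (ultralimit_le (U := U) (cvg_cst e) h de).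
    by rewrite xx' subrr normr0 leNgt e0.
  apply/eqP; rewrite -subr_eq0; apply/eqP.
  apply: (dense_duality_separates hJ dD) => j.
  rewrite linearB/=; apply/eqP; rewrite subr_eq0; apply/eqP.
  apply: (cvg_unique (@Rhausdorff R) (x'U (J (D j)))).
  apply: (cvg_trans _ (_ : (J (D j) (u (c (d n))) : R) @[n --> \oo] --> _)).
    exact: cvg_app.
  apply: (subseq_cvg (u := fun k => J (D j) (u (c k)) : R)) => //.
  apply/cvgrPdist_lt => e1 e10; near=> k.
  apply: (@lt_trans _ _ k.+1%:R^-1).
    by have [_] := cE k; apply; near: k; exists j.
  by near: k; exact: near_infty_natSinv_lt (PosNum e10).
move=> k.
have : U [set n | (k <= n)%N /\
    forall j, (j <= k)%N -> `|(J (D j) x : R) - J (D j) (u n)| < k.+1%:R^-1].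
  apply: filterI; first by apply: sU; exists k.
  have : \forall n \near U, forall j : 'I_k.+1,
      `|(J (D j) x : R) - J (D j) (u n)| < k.+1%:R^-1.
    apply: filter_forall => j.
    by apply: (cvgr_dist_lt _ _ (xU (J (D j)))); rewrite invr_gt0.
  apply: filterS => n h j jk.
  by have := h (Ordinal (jk : (j < k.+1)%N)).
by move=> /filter_ex[n]; exists n.
Unshelve. all: by end_near. Qed.

End weak_compactness.

(** The sequence enumerates the rational combinations of the spanning families of the
approximating subspaces. *)
Lemma approximation_dense_sequence (R : realType) (X : normedModType R) :
  has_approximation X -> exists D : nat -> X, dense_sequence D.
Proof.
move=> [Y [_ [finY _ _ _ denseY]]].
have /choice[b bY] : forall n, exists b : {d : nat & 'I_d -> X},
    Y n = range (fun c : 'I_(projT1 b) -> R => \sum_i c i *: projT2 b i).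
  by move=> n; have [d [b ->]] := finY n; exists (existT _ d b).
pose I := {n : nat & {ffun 'I_(projT1 (b n)) -> rat}}.
pose comb (i : I) : X := \sum_k ratr (projT2 i k) *: projT2 (b (projT1 i)) k.
exists (fun j => if unpickle j is Some i then comb i else 0) => v e e0.
suff [i iv] : exists i : I, `|comb i - v| < e.
  by exists (pickle i); rewrite pickleK.
have e20 : 0 < e / 2 by rewrite divr_gt0.
have [||y [vy [n _]]] := denseY (ball v (e / 2)).
- by exists v; exact: ballxx.
- exact: ball_open.
rewrite bY => -[c _ cy].
pose M := \sum_k `|projT2 (b n) k| + 1.
have M0 : 0 < M by rewrite ltr_wpDl// sumr_ge0.
have dl : 0 < e / 2 / M by rewrite divr_gt0.
have /choice[q qc] : forall k, exists q : rat, `|ratr q - c k| <= e / 2 / M.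
  move=> k; have [|q] := @rat_in_itvoo _ (c k - e / 2 / M) (c k + e / 2 / M).
    by lra.
  rewrite in_itv/= => /andP[q1 q2]; exists q.
  by rewrite ler_distlC; apply/andP; split; lra.
exists (existT _ n [ffun k => q k]).
have -> : comb (existT _ n [ffun k => q k]) - v =
    (comb (existT _ n [ffun k => q k]) - y) + (y - v) by rewrite addrA subrK.
apply: le_lt_trans (ler_normD _ _) _.
have : `|y - v| < e / 2 by rewrite distrC; move: vy; rewrite -ball_normE.
suff : `|comb (existT _ n [ffun k => q k]) - y| <= e / 2 by lra.
rewrite -cy /comb /= -sumrB (le_trans (ler_norm_sum _ _ _))//.
apply: (@le_trans _ _ (\sum_k e / 2 / M * `|projT2 (b n) k|)).
  apply: ler_sum => k _; rewrite ffunE -scalerBl normrZ.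
  exact: ler_wpM2r.
by rewrite -mulr_sumr mulrAC ler_pdivrMr// ler_pM2l// lerDl.
Qed.

(** * Asymptotic centres *)

Section uniform_convexity.
Context {R : realType}.

(** Vectors of the ball whose norm is below [1 - a] have a short midpoint by the
triangle inequality; the others are within [a] of the unit sphere, where uniform
convexity applies. *)
Lemma uniformly_convex_ball (X : normedModType R) (e : R) :
  uniformly_convex X -> 0 < e ->
  exists2 d : R, 0 < d & forall x y : X, `|x| <= 1 -> `|y| <= 1 ->
    e <= `|x - y| -> `|2^-1 *: (x + y)| <= 1 - d.
Proof.
move=> ucX e0.
have [d d0 dX] := ucX _ (divr_gt0 e0 (ltr0Sn R 1)).
pose a := Num.min (e / 4) (d / 2).
have ae : a <= e / 4 by rewrite ge_min lexx.
have ad : a <= d / 2 by rewrite ge_min lexx orbT.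
have a0 : 0 < a by rewrite lt_min !divr_gt0.
exists (a / 2); first by rewrite divr_gt0.
have half (x y : X) : `|2^-1 *: (x + y)| = `|x + y| / 2.
  by rewrite normrZ gtr0_norm ?invr_gt0// mulrC.
move=> x y x1 y1 exy; rewrite half.
have := ler_normD x y; have := ler_normB x y.
have [xa|xa] := leP `|x| (1 - a); first lra.
have [ya|ya] := leP `|y| (1 - a); first lra.
move=> e2 _.
have normalize (z : X) : `|z| <= 1 -> 1 - a < `|z| ->
    exists2 w : X, `|w| = 1 & `|z - w| <= a.
  move=> z1 za; have z0 : 0 < `|z| by lra.
  exists (`|z|^-1 *: z).
    by rewrite normrZ normfV normr_id mulVf// gt_eqF.
  rewrite -{1}[z]scale1r -scalerBl normrZ -[X in _ * X]normr_id -normrM.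
  by rewrite mulrBl mul1r mulVf ?gt_eqF// distrC ger0_norm; lra.
have [u u1 xu] := normalize _ x1 xa.
have [v v1 yv] := normalize _ y1 ya.
have uv : e / 2 <= `|u - v|.
  have : x - y = (u - v) + ((x - u) - (y - v)).
    by rewrite !opprD !opprK !addrA [RHS](ACl (3*5*(1*4)*(2*6))%AC)/= subrr addNr !addr0.
  move=> /(congr1 (fun z => `|z|)) xyE.
  have := ler_normD (u - v) ((x - u) - (y - v)); rewrite -xyE.
  have := ler_normB (x - u) (y - v); lra.
have := dX u v u1 v1 uv; rewrite half.
have : `|x + y| <= `|u + v| + (`|x - u| + `|y - v|).
  have -> : x + y = (u + v) + ((x - u) + (y - v)).
    by rewrite !addrA [RHS](ACl (3*5*(1*4)*(2*6))%AC)/= !subrr !addr0.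
  by rewrite (le_trans (ler_normD _ _))// lerD2l ler_normD.
lra.
Qed.

(** Here [m y] is the asymptotic distance from [u] to [y].  Two points whose asymptotic
distance is almost minimal must be close, as otherwise uniform convexity makes
their midpoint better than the infimum; so minimizing sequences converge and the
minimizer is unique. *)
Lemma asymptotic_centre (X : completeNormedModType R) (U : set_system nat)
    (u : nat -> X) (C : R) :
  uniformly_convex X -> UltraFilter U -> (forall n, `|u n| <= C) ->
  exists (m : X -> R) (c : X),
    (forall y, `|u n - y| @[n --> U] --> m y) /\
    forall y, m c <= m y /\ (m y <= m c -> y = c).
Proof.
move=> ucX FU uC.
have /choice[m mE] : forall y, exists l : R, `|u n - y| @[n --> U] --> l.
  move=> y; apply: (@bounded_ultralimit _ _ _ _ (C + `|y|)) => n.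
  by rewrite normr_id (le_trans (ler_normB _ _))// lerD2r.
have m0 y : 0 <= m y.
  by apply: (ultralimit_le (U := U) (cvg_cst (0 : R)) (mE y)).
have m_lip y z : m y <= m z + `|z - y|.
  have h : `|u n - z| + `|z - y| @[n --> U] --> m z + `|z - y|.
    by apply: cvgD; [exact: mE|exact: cvg_cst].
  apply: (ultralimit_le (U := U) (mE y) h) => n.
  by rewrite (le_trans _ (ler_normD _ _))// addrA subrK.
pose d := inf (range m).
have hi : has_inf (range m).
  by split; [exists (m 0), 0|exists 0 => _ [y _ <-]].
have d_le y : d <= m y by apply: ge_inf; [exact: hi.2|exists y].
have d0 : 0 <= d by apply: lb_le_inf; [exact: hi.1|move=> _ [y _ <-]].
have diam e : 0 < e -> exists2 a, 0 < a & forall x y,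
    m x - d < a -> m y - d < a -> `|x - y| <= e.
  move=> e0.
  have eventually_lt x a : m x < a -> \forall n \near U, `|u n - x| < a.
    by move=> xa; apply: (cvgr_lt _ (mE x)).
  (* The scaling below needs a positive radius [d]; if [d = 0], points with small
     asymptotic distance are close by the triangle inequality. *)
  have [dz|dz] := eqVneq d 0.
    exists (e / 2); first by rewrite divr_gt0.
    move=> x y; rewrite dz !subr0 => /eventually_lt xa /eventually_lt ya.
    have [n [nx ny]] := filter_ex (filterI xa ya).
    have -> : x - y = (u n - y) - (u n - x) by rewrite opprB [RHS]addrC addrA subrK.
    by rewrite (le_trans (ler_normB _ _))//; move: nx ny => /=; lra.
  have {d0 dz}d0 : 0 < d by rewrite lt_neqAle eq_sym dz.
  have ed0 : 0 < e / (2 * d) by rewrite divr_gt0// mulr_gt0.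
  have [b b0 bX] := uniformly_convex_ball ucX ed0.
  pose a := Num.min d (d * b / 2).
  have a0 : 0 < a by rewrite lt_min d0/= divr_gt0// mulr_gt0.
  have ad : a <= d by rewrite ge_min lexx.
  have adb : a <= d * b / 2 by rewrite ge_min lexx orbT.
  exists a => // x y; rewrite !ltrBlDr => xa ya; rewrite leNgt; apply/negP => exy.
  have r0 : 0 < a + d by rewrite addr_gt0.
  suff : m (2^-1 *: (x + y)) <= (a + d) * (1 - b).
    have := d_le (2^-1 *: (x + y)).
    have : 0 <= a * b by rewrite mulr_ge0// ltW.
    lra.
  apply: (ler_cvg_to (mE _) (cvg_cst _)).
  have H : U ([set n | `|u n - x| < a + d] `&` [set n | `|u n - y| < a + d]).
    by apply: filterI; exact: eventually_lt.
  apply: filterS H => n [/= nx ny].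
  pose p := (a + d)^-1 *: (u n - x); pose q := (a + d)^-1 *: (u n - y).
  have scale_le (w : X) : `|w| < a + d -> `|(a + d)^-1 *: w| <= 1.
    move=> wr; rewrite normrZ gtr0_norm ?invr_gt0// ler_pdivrMl// mulr1.
    exact: ltW.
  have epq : e / (2 * d) <= `|p - q|.
    rewrite /p /q -scalerBr opprB [X in _ *: X]addrC addrA subrK normrZ gtr0_norm ?invr_gt0//.
    rewrite ler_pdivlMl// distrC (le_trans _ (ltW exy))//.
    rewrite mulrA ler_pdivrMr ?mulr_gt0// mulrC ler_pM2l//; lra.
  have := bX p q (scale_le _ nx) (scale_le _ ny) epq.
  rewrite /p /q -scalerDr scalerA mulrC -scalerA normrZ gtr0_norm ?invr_gt0//.
  rewrite ler_pdivrMl//; congr (`|_| <= _).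
  rewrite addrACA -opprD scalerBr; congr (_ - _).
  by rewrite -mulr2n -[u n *+ 2]scaler_nat scalerA mulVf // scale1r.
have [||c cE] := @well_posed_limit R X (fun y => m y - d).
- move=> e e0; have [_ [y _ <-] ye] := inf_adherent e0 hi.
  by exists y; rewrite ltrBlDl.
- by move=> e /diam.
have mc : m c = d.
  apply/eqP; rewrite eq_le d_le andbT; apply/ler_addgt0Pr => e e0.
  have e20 : 0 < e / 2 by rewrite divr_gt0.
  have [y yd cy] := cE _ _ e20 e20.
  by apply: le_trans (m_lip c y) _; rewrite distrC; lra.
exists m, c; split=> // y; split; first by rewrite mc.
rewrite mc => yd; apply/eqP; rewrite -subr_eq0 -normr_le0.
apply/ler_addgt0Pr => e e0; rewrite add0r.
by have [a a0 H] := diam e e0; apply: H; rewrite ?mc; lra.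
Qed.

End uniform_convexity.

(** * Convergence of the regularized solutions *)

Section regularization_path.
Context {R : realType} {X : completeNormedModType R} (J : X -> dual X).
Hypothesis hJ : forall x, duality_map x = [set J x].
Context {N : nat} (A : 'I_N -> X -> X).
Hypothesis aA : forall i, accretive J (A i).
Hypothesis bA : forall i, ball_uniform (A i).

(** The properties of the regularized solutions that survive in subsequences and
determine their limit. *)
Definition regularization_path (x : nat -> X) :=
  [/\ exists C : R, forall k, `|x k| <= C,
      forall y, common_zeros A y -> forall k, (J (x k - y) (x k) : R) <= 0
    & forall i, A i (x k) @[k --> \oo] --> (0 : X)].

Lemma regularization_path_subseq (x : nat -> X) (c : nat -> nat) :
  (forall k, (k <= c k)%N) -> regularization_path x ->
  regularization_path (x \o c).
Proof.
move=> kc [[C xC] xS xA]; split; first by exists C => k; exact: xC.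
- by move=> y Sy k; exact: xS.
- by move=> i; exact: (subseq_cvg kc (xA i)).
Qed.

Lemma regularization_path_sqr_le x y k : regularization_path x ->
  common_zeros A y -> `|x k - y| ^+ 2 <= (J (x k - y) (- y) : R).
Proof.
move=> [_ xS _] Sy; rewrite -(duality_self hJ) linearB linearN/=.
by have := xS _ Sy k; rewrite gerDr.
Qed.

Lemma resolvent_exists i c : exists p, A i p = c - p.
Proof.
have [p pc] := accretive_solvable hJ c ltr01 (aA i) (bA i).
by exists p; rewrite -pc scale1r addrK.
Qed.

(** Let [p] be the point with [p + A i p = c].  The accretivity of [A i] between [p] and
[x k] passes to the weak limit because [J] does, and gives
[0 <= J (p - c) (A i p) = - `|p - c| ^+ 2], so that [c = p] is a zero of [A i]. *)
Lemma weak_limit_common_zero x c : regularization_path x ->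
  seq_weakly_continuous J -> weak_cvg x c -> common_zeros A c.
Proof.
move=> [[C xC] _ xA] wJ xc i.
have [p pc] := resolvent_exists i c.
have wp : weak_cvg (fun k => p - x k) (p - c).
  move=> f; rewrite linearB; under eq_fun do rewrite linearB.
  by apply: cvgB; [exact: cvg_cst|exact: xc].
have [Phi [PhiE _]] := dual_evaluation (A i p).
have h1 : (J (p - x k) (A i p) : R) @[k --> \oo] --> (J (p - c) (A i p) : R).
  by have := wJ _ _ wp Phi; rewrite PhiE; under eq_fun do rewrite PhiE.
have h2 : (J (p - c) (A i p) : R) >= 0.
  have h3 : (`|p| + C) * `|A i (x k)| @[k --> \oo] --> (`|p| + C) * `|0 : X|.
    by apply: cvgM; [exact: cvg_cst|apply: cvg_norm; exact: xA].
  rewrite normr0 mulr0 in h3.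
  have h4 : (J (p - x k) (A i p) : R) + (`|p| + C) * `|A i (x k)|
      @[k --> \oo] --> (J (p - c) (A i p) : R) + 0 by exact: cvgD.
  rewrite addr0 in h4.
  apply: (ler_cvg_to (cvg_cst (0 : R)) h4); apply: nearW => k /=.
  have := aA i p (x k); rewrite linearB/=.
  have : - ((`|p| + C) * `|A i (x k)|) <= (J (p - x k) (A i (x k)) : R).
    apply: le_trans (duality_ge hJ _ _); rewrite lerN2 ler_wpM2r//.
    by rewrite (le_trans (ler_normB _ _))// lerD2l.
  set u := (J _ (A i (x k)) : R); set v := (J _ (A i p) : R); lra.
have pcE : p = c.
  apply/eqP; rewrite -subr_eq0 -normr_le0.
  have : `|p - c| ^+ 2 <= 0.
    by rewrite -oppr_ge0 -(duality_self hJ) -linearN opprB -pc.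
  by rewrite exprn_even_le0//= => /eqP ->.
by rewrite -pcE pc pcE subrr.
Qed.

Lemma weak_limit_strong x c : regularization_path x ->
  seq_weakly_continuous J -> weak_cvg x c -> common_zeros A c ->
  x k @[k --> \oo] --> c.
Proof.
move=> xP wJ xc Sc.
have wp : weak_cvg (fun k => x k - c) 0.
  move=> f; rewrite linear0; under eq_fun do rewrite linearB.
  have : (f (x k) : R) - (f c : R) @[k --> \oo] --> (f c : R) - (f c : R).
    by apply: cvgB; [exact: xc|exact: cvg_cst].
  by rewrite subrr.
have [Phi [PhiE _]] := dual_evaluation (- c).
have h1 : (J (x k - c) (- c) : R) @[k --> \oo] --> (0 : R).
  have := wJ _ _ wp Phi; rewrite PhiE; under eq_fun do rewrite PhiE.
  suff -> : J 0 (- c) = 0 by [].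
  by apply/eqP; rewrite -normr_le0 (le_trans (dual_le_norm _ _))//
    (duality_norm hJ) normr0 mul0r.
apply/cvgrPdist_lt => e e0.
have : \forall k \near \oo, (J (x k - c) (- c) : R) < e ^+ 2.
  by apply: (cvgr_lt _ h1); exact: exprn_gt0.
apply: filterS => k kh.
rewrite distrC -(ltr_pXn2r (n := 2))// ?nnegrE ?(ltW e0)//.
exact: le_lt_trans (regularization_path_sqr_le k xP Sc) kh.
Qed.

(** The limit is the asymptotic centre [c] of [x].  The point [p] with
[p + A i p = c] is no farther from [x] than [c], asymptotically, because [A i (x k)]
tends to 0; uniqueness of the centre gives [p = c], hence [A i c = 0].  If the
asymptotic radius were positive, the variational inequality at [c] would make the
norm of [x k - c] decrease, when [c] moves towards the origin, at a rate bounded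
below, while the smoothness error is of smaller order: a point [c - s *: c] would be better than
the centre. *)
Lemma ultralimit_smooth_convex (U : set_system nat) x :
  UltraFilter U -> \oo `<=` U -> regularization_path x ->
  uniformly_smooth X -> uniformly_convex X ->
  exists2 c, common_zeros A c & x k @[k --> U] --> c.
Proof.
move=> FU sU xP usX ucX.
have [[C xC] _ xA] := xP.
have [m [c [mE cmin]]] := asymptotic_centre ucX FU xC.
have Sc : common_zeros A c.
  move=> i; have [p pc] := resolvent_exists i c.
  suff /(cmin p).2 pE : m p <= m c by rewrite -pE pc pE subrr.
  have h : `|A i (x k)| + `|x k - c| @[k --> U] --> 0 + m c.
    apply: cvgD; last exact: mE.
    rewrite -(normr0 X); apply: cvg_norm.
    by apply: cvg_trans (xA i); exact: cvg_app.
  rewrite add0r in h; apply: (ultralimit_le (U := U) (mE p) h) => k.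
  rewrite -[`|x k - p|]mul1r.
  apply: le_trans (accretive_expansive hJ 1 (x k) p (aA i)) _.
  have -> : A i (x k) - A i p + 1 *: (x k - p) = A i (x k) + (x k - c).
    by rewrite scale1r pc opprB !addrA [LHS](ACl (1*4*3*(2*5))%AC)/= subrr addr0.
  exact: ler_normD.
exists c => //.
have m0 : 0 <= m c.
  by apply: (ultralimit_le (U := U) (cvg_cst (0 : R)) (mE c)).
have [mc0|mc0] := eqVneq (m c) 0.
  have := mE c; rewrite mc0 => h; apply/cvgrPdist_lt => e e0.
  have : \forall k \near U, `|x k - c| < e by apply: (cvgr_lt _ h).
  by apply: filterS => k; rewrite distrC.
have {m0 mc0}mc : 0 < m c by rewrite lt_neqAle eq_sym mc0.
exfalso.
have v0 : 0 < 4 * `|c| + 1 by rewrite ltr_wpDl// mulr_ge0.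
have [t [t0 t1 ht]] : exists t, [/\ 0 < t, t <= 1 &
    (4 * `|c| + 1) * smoothness_quotient X t < m c].
  have e0 : 0 < m c / (4 * `|c| + 1) by rewrite divr_gt0.
  have hlt : \forall t \near (0 : R)^'+, smoothness_quotient X t < m c / (4 * `|c| + 1).
    exact: (cvgr_lt _ usX).
  have t1 : \forall t \near (0 : R)^'+, t <= 1 by exact: nbhs_right_le.
  have t0 : \forall t \near (0 : R)^'+, 0 < t by exact: nbhs_right_gt.
  have [t [[h1 h2] h3]] := filter_ex (filterI (filterI t0 t1) hlt).
  by exists t; split=> //; rewrite mulrC -ltr_pdivlMr.
pose s := t * (m c / 2) / (`|c| + 1).
have c1 : 0 < `|c| + 1 by rewrite ltr_wpDl.
have s0 : 0 < s by rewrite divr_gt0// mulr_gt0// divr_gt0.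
have sc : s * `|c| <= t * (m c / 2).
  rewrite /s mulrAC ler_pdivrMr// ler_wpM2l ?lerDl//.
  by rewrite mulr_ge0 ?ltW// divr_gt0.
have big : \forall k \near U, m c / 2 < `|x k - c|.
  by apply: (cvgr_gt _ (mE c)); lra.
have : m (c - s *: c) <= (1 - s) * m c + 2 * (s * `|c|) * smoothness_quotient X t.
  have h : (1 - s) * `|x k - c| + 2 * (s * `|c|) * smoothness_quotient X t @[k --> U]
     --> (1 - s) * m c + 2 * (s * `|c|) * smoothness_quotient X t.
    by apply: cvgD; [apply: cvgM; [exact: cvg_cst|exact: mE]|exact: cvg_cst].
  apply: (ler_cvg_to (mE _) h); apply: filterS big => k kbig.
  have w0 : 0 < `|x k - c| by apply: lt_trans kbig; lra.
  have nsc : `|s *: - c| = s * `|c| by rewrite normrZ gtr0_norm// normrN.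
  have -> : x k - (c - s *: c) = (x k - c) - s *: - c.
    by rewrite scalerN opprK opprB addrA addrAC addrC.
  have ytw : `|s *: - c| <= t * `|x k - c|.
    by rewrite nsc (le_trans sc)// ler_pM2l// ltW.
  have wn0 : x k - c != 0 by rewrite -normr_gt0.
  apply: le_trans (norm_sub_smooth hJ wn0 t0 ytw) _.
  rewrite nsc lerD2r mulrBl mul1r lerD2l lerN2 ler_pdivlMr// linearZ/=.
  rewrite -mulrA -expr2 /GRing.scale/= ler_pM2l//.
  exact: regularization_path_sqr_le.
have := (cmin (c - s *: c)).1.
have : s * (m c - 2 * `|c| * smoothness_quotient X t) > 0.
  rewrite mulr_gt0// subr_gt0.
  have := smoothness_quotient_ge0 (X := X) t0.
  move: (smoothness_quotient X t) ht => q ht q0.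
  have := mulr_ge0 (normr_ge0 c) q0; lra.
lra.
Qed.

(** The expression [J (w - z) w = `|w - z| ^+ 2 + J (w - z) z] is continuous in [w] by
demicontinuity of [J], so every strong cluster point in the set of common zeros
satisfies the variational inequality that singles out [xhat]. *)
Lemma regularization_path_cvg x xhat : regularization_path x ->
  unique (fun x => common_zeros A x /\
     forall y, common_zeros A y -> J (x - y) x <= 0) xhat ->
  (forall c : nat -> nat, (forall k, (k <= c k)%N) ->
     exists V : set_system nat, ProperFilter V /\
       exists2 l, common_zeros A l & x (c k) @[k --> V] --> l) ->
  x k @[k --> \oo] --> xhat.
Proof.
move=> [[C xC] xS _] [_ xhat_unique] sub; apply: contrapT => /not_cvg_subseq.
move=> [e e0 [c kc ce]].
have [V [PV [l Sl xl]]] := sub c kc.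
have [U [FU sU]] := ultraFilterLemma PV.
have {xl}xl : x (c k) @[k --> U] --> l by apply: cvg_trans xl; exact: cvg_app.
have lE : xhat = l.
  apply: xhat_unique; split => // y Sy.
  have xly : x (c k) - y @[k --> U] --> l - y by apply: cvgB => //; exact: cvg_cst.
  have bxy k : `|x (c k) - y| <= C + `|y|.
    by rewrite (le_trans (ler_normB _ _))// lerD2r.
  have h1 : (J (x (c k) - y) y : R) @[k --> U] --> (J (l - y) y : R).
    exact: (duality_demicontinuous hJ FU bxy xly).
  have h2 : `|x (c k) - y| ^+ 2 + (J (x (c k) - y) y : R) @[k --> U]
      --> `|l - y| ^+ 2 + (J (l - y) y : R).
    by apply: cvgD => //; apply: cvgM; exact: cvg_norm.
  have Jsplit w z : (J (w - z) w : R) = `|w - z| ^+ 2 + (J (w - z) z : R).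
    rewrite -(duality_self hJ) -[in LHS](subrK z w) subrK.
    by rewrite -{2}(subrK z w) linearD.
  rewrite Jsplit; apply: (ultralimit_le (U := U) h2 (cvg_cst (0 : R))) => k.
  by rewrite -Jsplit; exact: xS.
have h : `|xhat - x (c k)| @[k --> U] --> `|xhat - l|.
  by apply: cvg_norm; apply: cvgB => //; exact: cvg_cst.
have : e <= `|xhat - l| by apply: (ultralimit_le (U := U) (cvg_cst e) h ce).
by rewrite lE subrr normr0 leNgt e0.
Qed.

End regularization_path.

(** * The regularized equations *)

Section regularized.
Context {R : realType} {X : normedModType R} (J : X -> dual X).
Hypothesis hJ : forall x, duality_map x = [set J x].
Context {N : nat} (A : 'I_N -> X -> X).
Hypothesis aA : forall i, accretive J (A i).

Definition regularized_solution (a : R) (x : X) :=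
  \sum_(i < N) A i x + a *: x = 0.

(** The bounds on a regularized solution in terms of a common zero come from this
identity, whose left-hand side is a sum of nonnegative terms. *)
Lemma regularized_pairing a x y : regularized_solution a x -> common_zeros A y ->
  \sum_(i < N) (J (x - y) (A i x - A i y) : R) = - (a * (J (x - y) x : R)).
Proof.
move=> xE Sy.
have -> : \sum_(i < N) (J (x - y) (A i x - A i y) : R) =
    J (x - y) (\sum_(i < N) A i x).
  by rewrite linear_sum; apply: eq_bigr => i _; rewrite Sy subr0.
by move/eqP: xE; rewrite addr_eq0 => /eqP ->; rewrite linearN linearZ.
Qed.

Lemma regularized_variational a x y : 0 < a -> regularized_solution a x ->
  common_zeros A y -> (J (x - y) x : R) <= 0.
Proof.
move=> a0 xE Sy; rewrite -(pmulr_rle0 _ a0) -oppr_ge0.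
by rewrite -(regularized_pairing xE Sy); apply: sumr_ge0 => i _; exact: aA.
Qed.

Lemma regularized_dist a x y : 0 < a -> regularized_solution a x ->
  common_zeros A y -> `|x - y| <= `|y|.
Proof.
move=> a0 xE Sy.
have := regularized_variational a0 xE Sy.
rewrite -{2}(subrK y x) linearD/= (duality_self hJ).
have := duality_ge hJ (x - y) y.
set j := (J _ _ : R) => jge jle.
have [->|n0] := eqVneq `|x - y| 0; first exact: normr_ge0.
have {}n0 : 0 < `|x - y| by rewrite lt_neqAle eq_sym n0 normr_ge0.
by rewrite -(ler_pM2l n0) -expr2; lra.
Qed.

Lemma regularized_gauge (phi : R -> R -> R) a x y r i : 0 < a -> 0 < r ->
  (forall i, inverse_uniformly_accretive J phi (A i)) ->
  regularized_solution a x -> common_zeros A y -> 2 * `|y| <= r ->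
  `|x| <= r /\ phi r `|A i x| <= 3 * r ^+ 2 / 2 * a.
Proof.
move=> a0 r0 hA xE Sy yr.
have xy := regularized_dist a0 xE Sy.
have xr : `|x| <= r.
  by rewrite -(subrK y x) (le_trans (ler_normD _ _))//; lra.
have yr' : `|y| <= r by have := normr_ge0 y; lra.
split => //.
have [_ _ /(_ r x y r0 xr yr')] := hA i; rewrite Sy subr0 => /le_trans; apply.
apply: (@le_trans _ _ (\sum_(i < N) (J (x - y) (A i x - A i y) : R))).
  rewrite (bigD1 i)//= Sy subr0 lerDl sumr_ge0// => j _.
  by have := aA j x y.
rewrite (regularized_pairing xE Sy) -mulrN mulrC ler_pM2r//.
have := duality_ge hJ (x - y) x; set j := (J _ _ : R) => jge.
have : `|x - y| * `|x| <= r * r.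
  by apply: ler_pM => //; apply: le_trans yr'.
rewrite expr2; have := mulr_gt0 r0 r0; lra.
Qed.

Lemma regularized_step a b x y r : 0 < a -> regularized_solution a x ->
  regularized_solution b y -> `|y| <= r -> a * `|x - y| <= `|b - a| * r.
Proof.
move=> a0 xE yE yr.
have := accretive_expansive hJ a x y (accretive_sum aA); move=> /le_trans; apply.
have -> : \sum_(i < N) A i x - \sum_(i < N) A i y + a *: (x - y) = (b - a) *: y.
  move/eqP: xE; rewrite addr_eq0 => /eqP ->.
  move/eqP: yE; rewrite addr_eq0 => /eqP ->.
  by rewrite opprK scalerBr scalerBl !addrA [LHS](ACl (1*3*2*4)%AC)/= addNr add0r.
by rewrite normrZ ler_wpM2l.
Qed.

End regularized.

(** * The iteration *)

Section iteration_step.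
Context {R : realType} {X : normedModType R} (J : X -> dual X).
Hypothesis hJ : forall x, duality_map x = [set J x].

(** Up to the error [e], [x] solves the same implicit equation with [x + g^-1 *: b] in
place of [z], and the resolvent of [G] turns the distance between the two
right-hand sides into the stated bound.  The vector [b] is free, so that it can
later be chosen with zero mean. *)
Lemma implicit_step_le (G : X -> X) (q p x z b : X) (l g e : R) :
  accretive J G -> 0 < g -> G p - q + (l + g) *: p = g *: z ->
  `|G x - q + l *: x - b| <= e ->
  (1 + l / g) * `|p - x| <= `|z - x - g^-1 *: b| + g^-1 * e.
Proof.
move=> aG g0 pE be.
rewrite -(ler_pM2l g0).
have -> : g * ((1 + l / g) * `|p - x|) = (l + g) * `|p - x|.
  by field; rewrite gt_eqF.
apply: le_trans (accretive_expansive hJ (l + g) p x aG) _.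
have -> : G p - G x + (l + g) *: (p - x) =
    g *: (z - x - g^-1 *: b) - (G x - q + l *: x - b).
  rewrite 3!scalerBr scalerA mulfV ?gt_eqF// scale1r -pE [(l + g) *: x]scalerDl.
  rewrite !opprD !opprK !addrA.
  by rewrite [RHS](ACl (1*6*3*8*4*(2*7)*(5*9))%AC)/= !addNr !addr0.
rewrite (le_trans (ler_normB _ _))// normrZ gtr0_norm// mulrDr lerD2l.
by rewrite mulrA mulfV ?gt_eqF// mul1r.
Qed.

(** The linear parts [J w (b i)] cancel in the mean because the [b i] add up to 0. *)
Lemma mean_smooth_le (N : nat) (w : X) (b : 'I_N -> X) (t B : R) : (0 < N)%N ->
  \sum_(i < N) b i = 0 -> w != 0 -> 0 < t ->
  (forall i, `|b i| <= `|w|) -> (forall i, `|b i| <= B) ->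
  N%:R^-1 * \sum_(i < N) `|w - t *: b i| <=
    `|w| + 2 * t * B * smoothness_quotient X t.
Proof.
move=> N0 sb w0 t0 bw bB.
have NR : 0 < N%:R :> R by rewrite ltr0n.
rewrite mulrC ler_pdivrMr//.
have h0 := smoothness_quotient_ge0 (X := X) t0.
apply: (@le_trans _ _ (\sum_(i < N) ((`|w| + 2 * t * B * smoothness_quotient X t)
    - t / `|w| * (J w (b i) : R)))).
  apply: ler_sum => i _.
  have tb : `|t *: b i| = t * `|b i| by rewrite normrZ gtr0_norm.
  have tbw : `|t *: b i| <= t * `|w| by rewrite tb ler_pM2l.
  apply: le_trans (norm_sub_smooth hJ w0 t0 tbw) _.
  have Jt : (J w (t *: b i) : R) = t * (J w (b i) : R) by rewrite linearZ.
  rewrite tb Jt.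
  have : t * `|b i| * smoothness_quotient X t <= t * B * smoothness_quotient X t.
    by rewrite ler_wpM2r// ler_pM2l.
  have -> : t * (J w (b i) : R) / `|w| = t / `|w| * (J w (b i) : R) by ring.
  lra.
rewrite sumrB -mulr_sumr.
have -> : \sum_(i < N) (J w (b i) : R) = 0.
  transitivity (J w (\sum_(i < N) b i) : R); first by rewrite linear_sum.
  by rewrite sb linear0.
by rewrite mulr0 subr0 sumr_const card_ord mulr_natr.
Qed.

Lemma norm_mean_sub_le (N : nat) (u : 'I_N -> X) (x : X) : (0 < N)%N ->
  `|N%:R^-1 *: \sum_(i < N) u i - x| <= N%:R^-1 * \sum_(i < N) `|u i - x|.
Proof.
move=> N0; have NR : 0 < N%:R :> R by rewrite ltr0n.
have {1}-> : x = N%:R^-1 *: \sum_(i < N) x.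
  by rewrite sumr_const card_ord -[x *+ N]scaler_nat scalerA mulVf ?scale1r ?gt_eqF.
rewrite -scalerBr -sumrB normrZ gtr0_norm ?invr_gt0// ler_pM2l ?invr_gt0//.
exact: ler_norm_sum.
Qed.

End iteration_step.

(** Above the level [e], [w] decreases by multiples of the terms of a divergent series,
so it must come down to that level; from then on it never exceeds twice the
level. *)
Lemma descent_cvg0 (R : realType) (w a : nat -> R) :
  (forall n, 0 <= w n) -> (forall n, 0 < a n) ->
  (\sum_(1 <= k < n) a k) @[n --> \oo] --> +oo ->
  (forall e, 0 < e -> exists2 c, 0 < c & \forall n \near \oo,
     (e <= w n -> w n.+1 <= w n - c * a n) /\ (w n < e -> w n.+1 <= 2 * e)) ->
  w n @[n --> \oo] --> (0 : R).
Proof.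
move=> w0 a0 /cvgryPge suma step; apply/cvgrPdist_le => e e0.
have [c c0 [n0 _ hn0]] := step _ (divr_gt0 e0 (ltr0Sn R 1)).
have [n1 [n01 wn1]] : exists n1, (n0 <= n1)%N /\ w n1 <= e.
  apply: contrapT => H.
  have wlarge n : (n0 <= n)%N -> e < w n.
    by move=> n0n; rewrite ltNge; apply/negP => we; apply: H; exists n.
  have decr k : w (n0.+1 + k)%N <= w n0.+1 - c * \sum_(n0.+1 <= j < n0.+1 + k) a j.
    elim: k => [|k IH]; first by rewrite addn0 big_geq// mulr0 subr0.
    rewrite addnS big_nat_recr/= ?leq_addr// mulrDr.
    have n0k : (n0 <= n0.+1 + k)%N by rewrite ltnW// leq_addr.
    have [/(_ _) h _] := hn0 (n0.+1 + k)%N n0k.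
    have := wlarge _ n0k => wl; have := h ltac:(lra); lra.
  have [n2 _ hn2] := suma ((w n0.+1 + 1) / c + \sum_(1 <= k < n0.+1) a k).
  have := hn2 (n0.+1 + n2)%N (leq_addl _ _).
  rewrite /= [leRHS](big_cat_nat _ (n := n0.+1))//= ?leq_addr//.
  rewrite [leLHS]addrC lerD2l ler_pdivrMr// => h.
  have := decr n2; have := w0 (n0.+1 + n2)%N; lra.
exists n1 => // n /= n1n; rewrite sub0r normrN ger0_norm//.
rewrite -(subnKC n1n); elim: (n - n1)%N => [|k IH]; first by rewrite addn0.
rewrite addnS; have n0k : (n0 <= n1 + k)%N by rewrite (leq_trans n01)// leq_addr.
have [h1 h2] := hn0 _ n0k.
have [wl|wl] := leP (e / 2) (w (n1 + k)%N); last by have := h2 wl; lra.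
have := h1 wl; have := mulr_gt0 c0 (a0 (n1 + k)%N); lra.
Qed.

(** This is [1 / (1 + t) <= 1 - t / 2] on the unit interval. *)
Lemma relaxed_step_le (R : realType) (t v w s : R) : 0 <= t -> t <= 1 ->
  0 <= w -> 0 <= s -> (1 + t) * v <= w + s -> v <= w - t * w / 2 + s.
Proof.
move=> t0 t1 w0 s0 vws.
have p : 0 < 1 + t by lra.
rewrite -(ler_pM2l p); apply: (le_trans vws).
have ts := mulr_ge0 t0 s0.
have tw : 0 <= t * w * (1 - t) by rewrite !mulr_ge0// subr_ge0.
have -> : (1 + t) * (w - t * w / 2 + s) =
  w + s + t * s + t * w * (1 - t) / 2 by field.
lra.
Qed.

Theorem theorem2 (R : realType) (X : completeNormedModType R)
  (J : X -> dual X) (hJ : forall x, duality_map x = [set J x])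
  (N : nat) (hN : (1 <= N)%N)
  (F : 'I_N -> X -> X) (f : 'I_N -> X)
  (A : 'I_N -> X -> X) (hA : forall i x, A i x = F i x - f i)
  (hS : common_zeros A !=set0)
  (phi : R -> R -> R)
  (hAB :
    [/\ forall i, inverse_uniformly_accretive J phi (A i),
        seq_weakly_continuous J, continuous J
      & [/\ smooth_space X, reflexive_space X & has_approximation X]]
    \/
    [/\ forall i, m_accretive J (A i),
        forall i, inverse_uniformly_accretive J phi (A i),
        uniformly_smooth X & uniformly_convex X])
  (xhat : X)
  (hxhat : unique (fun x => common_zeros A x /\
     forall y, common_zeros A y -> J (x - y) x <= 0) xhat)
  (alpha gamma : nat -> R)
  (alpha_gt0 : forall n, 0 < alpha n) (gamma_gt0 : forall n, 0 < gamma n)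
  (alpha_cvg : alpha n @[n --> \oo] --> (0 : R))
  (gamma_cvg : gamma n @[n --> \oo] --> +oo)
  (step_cvg : gamma n * `|alpha n.+1 - alpha n| / alpha n ^+ 2
     @[n --> \oo] --> (0 : R))
  (sum_div : (\sum_(1 <= k < n) alpha k / gamma k) @[n --> \oo] --> +oo)
  (r r1 : R) (r_gt0 : 0 < r) (hr : 2 * `|xhat| <= r) (hr1 : r1 = 3 * r ^+ 2 / 2)
  (smooth_cvg : smoothness_quotient X (gamma n)^-1
       * gauge_inverse phi r (r1 * alpha n) / alpha n
     @[n --> \oo] --> (0 : R))
  (phi_superlinear : forall s, 0 < s -> phi s t / t @[t --> +oo] --> +oo)
  (Fp : nat -> 'I_N -> X -> X) (fp : nat -> 'I_N -> X)
  (Fp_accretive : forall n i, accretive J (Fp n i))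
  (g : R -> R) (g_ge0 : forall t, 0 <= t -> 0 <= g t)
  (g_cont : {within `[0, +oo[, continuous g})
  (g_ndecr : forall t u, 0 <= t -> t <= u -> g t <= g u)
  (h delta : nat -> R)
  (h_gt0 : forall n, 0 < h n) (delta_gt0 : forall n, 0 < delta n)
  (Fp_near : forall n i x, `|Fp n i x - F i x| <= h n * g `|x|)
  (fp_near : forall n i, `|fp n i - f i| <= delta n)
  (err_cvg : (h n + delta n) / alpha n @[n --> \oo] --> (0 : R))
  (z : nat -> X) (zi : nat -> 'I_N -> X)
  (zi_eq : forall n i,
     Fp n i (zi n i) - fp n i + (alpha n / N%:R + gamma n) *: zi n i
     = gamma n *: z n)
  (z_next : forall n, z n.+1 = N%:R^-1 *: \sum_(i < N) zi n i) :
  z n @[n --> \oo] --> xhat.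
Proof.
have iuA i : inverse_uniformly_accretive J phi (A i) by case: hAB => -[].
have aA i := inverse_uniformly_accretive_accretive (iuA i).
have bA i := inverse_uniformly_accretive_ball_uniform hJ (iuA i) phi_superlinear.
have NR : 0 < N%:R :> R by rewrite ltr0n.
pose i0 := Ordinal hN.
have hphi : accretivity_gauge phi by have [_ ] := iuA i0.
have Sxhat : common_zeros A xhat by have [[]] := hxhat.
have /choice[x xE] : forall n, exists x, regularized_solution A (alpha n) x.
  move=> n; apply: (accretive_solvable hJ 0 (alpha_gt0 n)).
    exact: accretive_sum.
  exact: ball_uniform_sum.
have xr n : `|x n| <= r.
  by have [] := regularized_gauge hJ aA i0 (alpha_gt0 n) r_gt0 iuA (xE n) Sxhat hr.
have xphi n i : phi r `|A i (x n)| <= r1 * alpha n.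
  rewrite hr1.
  by have [] := regularized_gauge hJ aA i (alpha_gt0 n) r_gt0 iuA (xE n) Sxhat hr.
have r10 : 0 < r1 by rewrite hr1 divr_gt0// mulr_gt0// exprn_gt0.
have xA i : A i (x k) @[k --> \oo] --> (0 : X).
  apply/cvgr0Pnorm_lt => e e0.
  have h1 : r1 * alpha k @[k --> \oo] --> r1 * 0.
    by apply: cvgM; [exact: cvg_cst|exact: alpha_cvg].
  rewrite mulr0 in h1.
  have h2 : \forall k \near \oo, r1 * alpha k < phi r e.
    by apply: (cvgr_lt _ h1); exact: gauge_gt0.
  apply: filterS h2 => k hk; rewrite ltNge; apply/negP => eA.
  have := gauge_le hphi r_gt0 (ltW e0) eA.
  by rewrite leNgt (le_lt_trans (xphi k i) hk).
have xP : regularization_path J A x.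
  split => //; first by exists r.
  move=> y Sy k; exact: (regularized_variational aA (alpha_gt0 k) (xE k) Sy).
have xcvg : x n @[n --> \oo] --> xhat.
  apply: (regularization_path_cvg hJ xP hxhat) => c kc.
  have cP := regularization_path_subseq kc xP.
  case: hAB => [[_ wJ _ [_ rX apX]]|[_ _ usX ucX]].
    have [D dD] := approximation_dense_sequence apX.
    have [C cC] : exists C, forall k, `|(x \o c) k| <= C by have [] := cP.
    have [c' kc' [l wl]] := reflexive_weak_subseq hJ dD rX cC.
    have c'P := regularization_path_subseq kc' cP.
    have Sl := weak_limit_common_zero hJ aA bA c'P wJ wl.
    exists (c' @ \oo); split; first exact: fmap_proper_filter.
    by exists l => //; exact: (weak_limit_strong hJ c'P wJ wl Sl).
  have [U [FU sU]] := ultraFilterLemma eventually_filter.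
  exists U; split; first exact: ultra_proper.
  exact: (ultralimit_smooth_convex hJ aA bA FU sU cP usX ucX).
pose tau n := (gamma n)^-1.
pose w n := `|z n - x n|.
suff wcvg : w n @[n --> \oo] --> (0 : R).
  have -> : z = (fun n => (z n - x n) + x n) by apply/funext => n; rewrite subrK.
  rewrite -[X in _ --> X]add0r; apply: cvgD => //.
  apply/cvgr0Pnorm_lt => e e0.
  by apply: (cvgr_lt _ wcvg).
apply: (descent_cvg0 _ _ sum_div) => [n|n|e e0]; first exact: normr_ge0.
  by rewrite divr_gt0.
pose Phi n := gauge_inverse phi r (r1 * alpha n).
pose q n := smoothness_quotient X (gamma n)^-1.
pose C := g r + 1.
pose b n i := A i (x n) + (alpha n / N%:R) *: x n.
(* All the errors of one step, divided by [alpha n / gamma n]: smoothness, data, and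
   the change of the regularization parameter. *)
pose err n := 4 * (q n * Phi n / alpha n) + C * ((h n + delta n) / alpha n)
  + r * (gamma n * `|alpha n.+1 - alpha n| / alpha n ^+ 2).
have err0 : err n @[n --> \oo] --> (0 : R).
  have -> : 0 = 4 * 0 + C * 0 + r * 0 :> R by rewrite !mulr0 !addr0.
  by apply: cvgD; [apply: cvgD|]; (apply: cvgM; [exact: cvg_cst|]).
have AN n : \sum_(i < N) A i (x n) = - (alpha n *: x n).
  by apply/eqP; rewrite -addr_eq0; apply/eqP; exact: xE.
have sb n : \sum_(i < N) b n i = 0.
  rewrite big_split/= AN sumr_const card_ord -[_ *+ N]scaler_nat scalerA.
  by rewrite mulrC divfK ?gt_eqF// addNr.
have APhi n i : `|A i (x n)| <= Phi n.
  exact: (gauge_inverse_ge hphi phi_superlinear).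
have bPhi n i : `|b n i| <= 2 * Phi n.
  (* The regularized equation turns [alpha n *: x n] into the sum of the
     [A i (x n)]. *)
  have : `|(alpha n / N%:R) *: x n| <= Phi n.
    have -> : `|(alpha n / N%:R) *: x n| = N%:R^-1 * `|\sum_(i < N) A i (x n)|.
      have e1 : `|alpha n *: x n| = alpha n * `|x n| by rewrite normrZ gtr0_norm.
      rewrite AN normrN e1 normrZ gtr0_norm ?divr_gt0//.
      by rewrite mulrAC mulrC.
    rewrite ler_pdivrMl// (le_trans (ler_norm_sum _ _ _))//.
    apply: (@le_trans _ _ (\sum_(i < N) Phi n)); first exact: ler_sum.
    by rewrite sumr_const card_ord mulr_natl.
  have := APhi n i; have := ler_normD (A i (x n)) ((alpha n / N%:R) *: x n).
  rewrite -/(b n i); lra.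
have Phi0 n : 0 <= Phi n by exact: le_trans (normr_ge0 _) (APhi n i0).
have C0 : 0 <= C by rewrite addr_ge0// g_ge0// ltW.
have data n i : `|Fp n i (x n) - fp n i + (alpha n / N%:R) *: x n - b n i|
    <= C * (h n + delta n).
  have -> : Fp n i (x n) - fp n i + (alpha n / N%:R) *: x n - b n i =
      (Fp n i (x n) - F i (x n)) - (fp n i - f i).
    rewrite /b hA !opprD !opprK !addrA.
    by rewrite [LHS](ACl (1*4*2*5*(3*6))%AC)/= subrr addr0.
  rewrite (le_trans (ler_normB _ _))//.
  have := Fp_near n i (x n); have := fp_near n i.
  have : h n * g `|x n| <= h n * g r.
    by rewrite ler_pM2l//; apply: g_ndecr.
  have : 0 <= g r * delta n by rewrite mulr_ge0 ?g_ge0 ?ltW.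
  have := h_gt0 n; rewrite /C; lra.
pose v n := `|z n.+1 - x n|.
have mean n : (1 + alpha n / N%:R / gamma n) * v n <=
    N%:R^-1 * \sum_(i < N) `|z n - x n - (gamma n)^-1 *: b n i|
    + (gamma n)^-1 * (C * (h n + delta n)).
  have t0 : 0 < 1 + alpha n / N%:R / gamma n by rewrite addr_gt0// !divr_gt0.
  rewrite /v z_next.
  apply: le_trans (ler_wpM2l (ltW t0) (norm_mean_sub_le (zi n) (x n) hN)) _.
  rewrite mulrCA.
  have -> : (gamma n)^-1 * (C * (h n + delta n)) =
      N%:R^-1 * \sum_(i < N) (gamma n)^-1 * (C * (h n + delta n)).
    by rewrite sumr_const card_ord -[(_ * _) *+ N]mulr_natl mulrA mulVf ?mul1r ?gt_eqF.
  rewrite -mulrDr ler_pM2l ?invr_gt0// mulr_sumr -big_split/=.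
  apply: ler_sum => i _.
  exact: implicit_step_le (Fp_accretive n i) (gamma_gt0 n) (zi_eq n i) (data n i).
have wS n : w n.+1 <= v n + r * (`|alpha n.+1 - alpha n| / alpha n).
  have -> : r * (`|alpha n.+1 - alpha n| / alpha n) =
      (`|alpha n.+1 - alpha n| * r) / alpha n by ring.
  have xx : `|x n - x n.+1| <= `|alpha n.+1 - alpha n| * r / alpha n.
    rewrite ler_pdivlMr// mulrC.
    exact: (regularized_step hJ aA (alpha_gt0 n) (xE n) (xE n.+1) (xr n.+1)).
  apply: le_trans (lerD (lexx _) xx).
  by rewrite /w /v (le_trans _ (ler_normD _ _))// addrA subrK.
have b_small : \forall n \near \oo, forall i, `|b n i| <= e.
  apply: filter_forall => i.
  have h1 : b n i @[n --> \oo] --> (0 : X) + (0 / N%:R) *: xhat.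
    apply: cvgD; first exact: xA.
    by apply: cvgZ => //; apply: cvgM => //; exact: cvg_cst.
  rewrite mul0r scale0r addr0 in h1.
  have /cvgr0Pnorm_le := h1; exact.
have err_small : \forall n \near \oo, err n < e / (4 * N%:R).
  by apply: (cvgr_lt _ err0); rewrite divr_gt0// mulr_gt0.
have alpha_small : \forall n \near \oo, alpha n < 1 by apply: (cvgr_lt _ alpha_cvg).
have gamma_large : \forall n \near \oo, 4 <= gamma n by move/cvgryPge: gamma_cvg.
(* The contraction gains [alpha n / gamma n * e / (2 * N)] when [e <= w n]; half of
   it absorbs the errors. *)
exists (e / (4 * N%:R)); first by rewrite divr_gt0// mulr_gt0.
near=> n.
have bn : forall i, `|b n i| <= e by near: n.
have en : err n < e / (4 * N%:R) by near: n.
have an1 : alpha n < 1 by near: n.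
have gn4 : 4 <= gamma n by near: n.
have a0 := alpha_gt0 n; have g0 := gamma_gt0 n.
have tau0 : 0 < (gamma n)^-1 by rewrite invr_gt0.
pose t := alpha n / N%:R / gamma n.
have N1 : 1 <= N%:R :> R by rewrite ler1n.
have t0 : 0 < t by rewrite !divr_gt0.
have tau4 : (gamma n)^-1 <= 4^-1 by rewrite lef_pV2 ?posrE.
have atau : alpha n / gamma n <= 1.
  by rewrite ler_pdivrMr// mul1r; lra.
have aNt : alpha n / gamma n = N%:R * t by rewrite /t; field; rewrite !gt_eqF.
have t1 : t <= 1.
  by rewrite -(ler_pM2l NR) -aNt mulr1 (le_trans atau).
have q0 : 0 <= q n by apply: smoothness_quotient_ge0; rewrite invr_gt0.
pose s := 4 * (gamma n)^-1 * Phi n * q n + (gamma n)^-1 * (C * (h n + delta n)).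
have hd0 : 0 <= (gamma n)^-1 * (C * (h n + delta n)).
  apply: mulr_ge0; first exact: ltW tau0.
  by apply: mulr_ge0 => //; apply: addr_ge0; exact: ltW.
have sq0 : 0 <= 4 * (gamma n)^-1 * Phi n * q n.
  by apply: mulr_ge0 => //; do 2?[apply: mulr_ge0 => //]; exact: ltW tau0.
have sE : s + r * (`|alpha n.+1 - alpha n| / alpha n) = alpha n / gamma n * err n.
  by rewrite /s /err; field; rewrite !gt_eqF.
have serr : alpha n / gamma n * err n <= t * e / 4.
  have -> : t * e / 4 = alpha n / gamma n * (e / (4 * N%:R)).
    by rewrite /t; field; rewrite !gt_eqF.
  by rewrite ler_pM2l ?divr_gt0// ltW.
have te : t * e <= e by apply: ler_piMl => //; exact: ltW.
have v0 : 0 <= v n by exact: normr_ge0.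
have w0 : 0 <= w n by exact: normr_ge0.
have := mean n; rewrite -/t => meann; have wSn := wS n.
split=> [ew|we].
  have wn0 : z n - x n != 0 by rewrite -normr_gt0; exact: lt_le_trans ew.
  have bw i : `|b n i| <= `|z n - x n| by exact: le_trans (bn i) ew.
  have := mean_smooth_le hJ hN (sb n) wn0 tau0 bw (bPhi n).
  rewrite -/(q n) -/(w n) => smooth.
  have vs : (1 + t) * v n <= w n + s by rewrite /s; lra.
  have := relaxed_step_le (ltW t0) t1 w0 (addr_ge0 sq0 hd0) vs.
  have -> : e / (4 * N%:R) * (alpha n / gamma n) = t * e / 4.
    by rewrite /t; field; rewrite !gt_eqF.
  have : t * e <= t * w n by rewrite ler_pM2l.
  rewrite -/s; lra.
have : N%:R^-1 * \sum_(i < N) `|z n - x n - (gamma n)^-1 *: b n i| <= w n + 4^-1 * e.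
  rewrite ler_pdivrMl//.
  have -> : N%:R * (w n + 4^-1 * e) = \sum_(i < N) (w n + 4^-1 * e).
    by rewrite sumr_const card_ord mulr_natl.
  apply: ler_sum => i _; rewrite (le_trans (ler_normB _ _))// lerD2l.
  rewrite normrZ gtr0_norm ?invr_gt0//.
  by apply: ler_pM => //; rewrite invr_ge0 ltW.
have : v n <= (1 + t) * v n by rewrite ler_peMl//; lra.
rewrite /s in sE; lra.
Unshelve. all: by end_near. Qed.
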